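(* There is an algorithm that, given parameters $\epsilon,\delta>0$ and sample access to an unknown Bayesian network distribution $P$ on a known directed acyclic graph $G$ on $n$ vertices of in-degree at most $d$, where each variable takes values in a finite alphabet $\Sigma$, returns a Bayesian network $Q$ on $G$ such that $d_{TV}(P,Q)\le\epsilon$ with probability at least $1-\delta$. The algorithm takes $m=O(|\Sigma|^{d+1}n\log(|\Sigma|^{d+1}n)\epsilon^{-2}\log\frac1\delta)$ samples and runs in $O(|\Sigma|^{d+1}mn)$ time.
   Context: A Bayesian network on a directed acyclic graph $G$ with vertex set $[n]$ is a distribution $P$ of $(X_1,\dots,X_n)$ over $\Sigma^n$ such that for every $i$, $X_i$ is conditionally independent of its non-descendants given its parents in $G$; equivalently $P(x)=\prod_{i=1}^n\Pr_{X\sim P}[X_i=x_i\mid X_j=x_j\ \forall j\in\text{parents}(i)]$. A Bayesian network on $G$ is described by the conditional distributions of each $X_i$ given each assignment to its parents. *)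

(* Defs.v *)
From HB Require Import structures.
From mathcomp Require Import all_boot all_order all_algebra.
From mathcomp Require Import reals exp.

Set Implicit Arguments.
Unset Strict Implicit.
Unset Printing Implicit Defensive.

Import Order.TTheory GRing.Theory Num.Theory.
Local Open Scope ring_scope.

(* G i j means that there is an edge from i to j. *)
Definition acyclic (n : nat) (G : rel 'I_n) : Prop :=
  forall i j : 'I_n, G i j -> ~~ connect G j i.

Definition parents (n : nat) (G : rel 'I_n) (i : 'I_n) : {set 'I_n} :=
  [set j | G j i].

(* [connect] is reflexive, so i is not one of its own non-descendants. *)
Definition nondescendants (n : nat) (G : rel 'I_n) (i : 'I_n) : {set 'I_n} :=
  [set j | ~~ connect G i j].

Definition is_dist (R : realType) (T : finType) (P : T -> R) : Prop :=
  (forall x, 0 <= P x) /\ \sum_x P x = 1.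

Definition dTV (R : realType) (T : finType) (P Q : T -> R) : R :=
  2^-1 * \sum_x `|P x - Q x|.

(* Pr_{X ~ P}[X_j = x_j for all j in S] *)
Definition marg (R : realType) (n : nat) (Sigma : finType)
    (P : {ffun 'I_n -> Sigma} -> R) (S : {set 'I_n})
    (x : {ffun 'I_n -> Sigma}) : R :=
  \sum_(y : {ffun 'I_n -> Sigma} | [forall j in S, y j == x j]) P y.

(* Pr_{X ~ P}[X_S = x_S | X_C = x_C] *)
Definition cprob (R : realType) (n : nat) (Sigma : finType)
    (P : {ffun 'I_n -> Sigma} -> R) (S C : {set 'I_n})
    (x : {ffun 'I_n -> Sigma}) : R :=
  marg P (S :|: C) x / marg P C x.

(* X_A and X_B are conditionally independent given X_C. *)
Definition cond_indep (R : realType) (n : nat) (Sigma : finType)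
    (P : {ffun 'I_n -> Sigma} -> R) (A B C : {set 'I_n}) : Prop :=
  forall x : {ffun 'I_n -> Sigma}, 0 < marg P C x ->
    cprob P (A :|: B) C x = cprob P A C x * cprob P B C x.

Definition is_bayesnet (R : realType) (n : nat) (Sigma : finType)
    (G : rel 'I_n) (P : {ffun 'I_n -> Sigma} -> R) : Prop :=
  is_dist P /\
  forall i : 'I_n, cond_indep P [set i] (nondescendants G i) (parents G i).

(* The probability of E under m independent samples from P. *)
Definition iid_prob (R : realType) (T : finType) (P : T -> R) (m : nat)
    (E : pred (m.-tuple T)) : R :=
  \sum_(s : m.-tuple T | E s) \prod_(i < m) P (tnth s i).

(* The machine model is a uniform-cost real RAM, in structured form.  Its
   memory consists of integer arrays and real arrays, each with infinitely many
   cells; arrays are named by fixed numerals in the program text, cells are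
   addressed by computed integers.  Integer arithmetic is limited to addition
   and truncated subtraction, and there is no rounding of reals to integers, so
   that unit cost is not abused.  Constants are natural numbers only. *)
Inductive iexp : Type :=
| INum of nat
| IGet of nat & iexp
| IAdd of iexp & iexp
| ISub of iexp & iexp.

Inductive rexp : Type :=
| RInt of iexp
| RGet of nat & iexp
| RAdd of rexp & rexp
| RSub of rexp & rexp
| RMul of rexp & rexp
| RDiv of rexp & rexp.

Inductive bexp : Type :=
| BILt of iexp & iexp
| BRLt of rexp & rexp
| BNot of bexp
| BAnd of bexp & bexp.

Inductive cmd : Type :=
| Skip
| ISet of nat & iexp & iexp
| RSet of nat & iexp & rexp
| Sample of nat
| Seq of cmd & cmd
| If of bexp & cmd & cmd
| While of bexp & cmd.

(* [pending] lists the samples that the sampling oracle will return next; a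
   program can access it only through [Sample]. *)
Record state (R : realType) := State {
  imem : nat -> nat -> nat;
  rmem : nat -> nat -> R;
  pending : seq (seq nat) }.

Fixpoint ieval (R : realType) (st : state R) (e : iexp) : nat :=
  match e with
  | INum c => c
  | IGet a e1 => imem st a (ieval st e1)
  | IAdd e1 e2 => (ieval st e1 + ieval st e2)%N
  | ISub e1 e2 => (ieval st e1 - ieval st e2)%N
  end.

Fixpoint reval (R : realType) (st : state R) (e : rexp) : R :=
  match e with
  | RInt e1 => (ieval st e1)%:R
  | RGet a e1 => rmem st a (ieval st e1)
  | RAdd e1 e2 => reval st e1 + reval st e2
  | RSub e1 e2 => reval st e1 - reval st e2
  | RMul e1 e2 => reval st e1 * reval st e2
  | RDiv e1 e2 => reval st e1 / reval st e2
  end.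

Fixpoint beval (R : realType) (st : state R) (b : bexp) : bool :=
  match b with
  | BILt e1 e2 => (ieval st e1 < ieval st e2)%N
  | BRLt e1 e2 => reval st e1 < reval st e2
  | BNot b1 => ~~ beval st b1
  | BAnd b1 b2 => beval st b1 && beval st b2
  end.

Fixpoint icost (e : iexp) : nat :=
  match e with
  | INum _ => 1
  | IGet _ e1 => (icost e1).+1
  | IAdd e1 e2 | ISub e1 e2 => (icost e1 + icost e2).+1
  end.

Fixpoint rcost (e : rexp) : nat :=
  match e with
  | RInt e1 | RGet _ e1 => (icost e1).+1
  | RAdd e1 e2 | RSub e1 e2 | RMul e1 e2 | RDiv e1 e2 =>
      (rcost e1 + rcost e2).+1
  end.

Fixpoint bcost (b : bexp) : nat :=
  match b with
  | BILt e1 e2 => (icost e1 + icost e2).+1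
  | BRLt e1 e2 => (rcost e1 + rcost e2).+1
  | BNot b1 => (bcost b1).+1
  | BAnd b1 b2 => (bcost b1 + bcost b2).+1
  end.

Definition upd (T : Type) (M : nat -> nat -> T) (a j : nat) (v : T) :
    nat -> nat -> T :=
  fun a' j' => if (a' == a) && (j' == j) then v else M a' j'.

Definition upd_seq (M : nat -> nat -> nat) (a : nat) (v : seq nat) :
    nat -> nat -> nat :=
  fun a' j => if (a' == a) && (j < size v)%N then nth 0%N v j else M a' j.

(* exec c st t st' : started in st, the program c halts in st' after t time
   units.  A sample is charged its length. *)
Inductive exec (R : realType) : cmd -> state R -> nat -> state R -> Prop :=
| ExecSkip st : exec Skip st 1 st
| ExecISet a e1 e2 st :
    exec (ISet a e1 e2) st (icost e1 + icost e2).+1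
      (State (upd (imem st) a (ieval st e1) (ieval st e2)) (rmem st)
         (pending st))
| ExecRSet a e1 e2 st :
    exec (RSet a e1 e2) st (icost e1 + rcost e2).+1
      (State (imem st) (upd (rmem st) a (ieval st e1) (reval st e2))
         (pending st))
| ExecSample a I M x xs :
    exec (Sample a) (State I M (x :: xs)) (size x).+1
      (State (upd_seq I a x) M xs)
| ExecSeq c1 c2 st1 st2 st3 t1 t2 :
    exec c1 st1 t1 st2 -> exec c2 st2 t2 st3 ->
    exec (Seq c1 c2) st1 (t1 + t2)%N st3
| ExecIf b c1 c2 st st' t :
    exec (if beval st b then c1 else c2) st t st' ->
    exec (If b c1 c2) st (bcost b + t).+1 st'
| ExecWhileF b c st :
    ~~ beval st b -> exec (While b c) st (bcost b).+1 st
| ExecWhileT b c st1 st2 st3 t1 t2 :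
    beval st1 b -> exec c st1 t1 st2 -> exec (While b c) st2 t2 st3 ->
    exec (While b c) st1 (bcost b + t1 + t2).+1 st3.

Lemma exec_det (R : realType) (c : cmd) (st st1 st2 : state R) (t1 t2 : nat) :
  exec c st t1 st1 -> exec c st t2 st2 -> t1 = t2 /\ st1 = st2.
Proof.
move=> h; elim: h t2 st2 => {c st t1 st1} /=.
- by move=> st t2 st2 h; inversion h.
- by move=> a e1 e2 st t2 st2 h; inversion h.
- by move=> a e1 e2 st t2 st2 h; inversion h.
- by move=> a I M x xs t2 st2 h; inversion h.
- move=> c1 c2 s1 s2 s3 u1 u2 _ IH1 _ IH2 t2 st2 h.
  inversion h as [ | | | | ? ? ? s2' ? v1 v2 h1 h2 | | | ]; subst.
  have [? ?] := IH1 _ _ h1; subst.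
  by have [-> ->] := IH2 _ _ h2.
- move=> b c1 c2 s1 s2 u _ IH t2 st2 h.
  inversion h as [ | | | | | ? ? ? ? ? v h1 | | ]; subst.
  by have [-> ->] := IH _ _ h1.
- move=> b c s1 nb t2 st2 h.
  inversion h as [ | | | | | | | ? ? ? ? ? ? ? hb ]; subst => //.
  by rewrite hb in nb.
- move=> b c s1 s2 s3 u1 u2 bb _ IH1 _ IH2 t2 st2 h.
  inversion h as [ | | | | | | ? ? ? nb | ? ? ? s2' ? v1 v2 _ h1 h2 ]; subst.
    by rewrite bb in nb.
  have [? ?] := IH1 _ _ h1; subst.
  by have [-> ->] := IH2 _ _ h2.
Qed.

(* Symbols are presented to the machine as the numbers 0, ..., |Sigma| - 1. *)
Definition encode_sample (n : nat) (Sigma : finType)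
    (x : {ffun 'I_n -> Sigma}) : seq nat :=
  [seq val (enum_rank (x j)) | j <- enum 'I_n].

(* Input: integer array 0 holds n, |Sigma|, d; integer array 2 holds the
   concatenation of the parent lists of the vertices 0, ..., n - 1, and cell i
   of integer array 1 the position in it where the list of vertex i starts
   (so that cell n is its total length); real array 0 holds eps, delta.  All
   other cells are 0. *)
Definition input_state (R : realType) (n : nat) (Sigma : finType)
    (G : rel 'I_n) (d : nat) (eps delta : R)
    (s : seq {ffun 'I_n -> Sigma}) : state R :=
  State
    (fun a j => match a with
     | 0 => nth 0 [:: n; #|Sigma|; d] j
     | 1 => if (j <= n)%N then \sum_(i < n | (i < j)%N) #|parents G i| else 0
     | 2 => nth 0 (flatten [seq [seq val p | p <- enum (parents G i)]
                            | i <- enum 'I_n]) j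
     | _ => 0
     end%N)
    (fun a j => if a == 0%N then nth 0 [:: eps; delta] j else 0)
    [seq encode_sample x | x <- s].

(* Output: the conditional distributions are read off real array 1.  The table
   of vertex i is the block of |Sigma|^(d+1) cells starting at
   i * |Sigma|^(d+1), of which the first |Sigma|^(#parents + 1) are used; the
   entry Pr[X_i = a | X_p = u p for every parent p of i] has as offset the
   base-|Sigma| number with digits (u p) for the parents p in increasing order,
   followed by a. *)
Definition output_cpt (R : realType) (n : nat) (Sigma : finType)
    (G : rel 'I_n) (d : nat) (st : state R)
    (i : 'I_n) (u : {ffun 'I_n -> Sigma}) (a : Sigma) : R :=
  rmem st 1 (i * #|Sigma| ^ d.+1 +
    foldl (fun c v => c * #|Sigma| + v)%N 0%N
      (rcons [seq val (enum_rank (u p)) | p <- enum (parents G i)]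
         (val (enum_rank a))))%N.

Definition is_cpt (R : realType) (n : nat) (Sigma : finType)
    (q : 'I_n -> {ffun 'I_n -> Sigma} -> Sigma -> R) : Prop :=
  forall (i : 'I_n) (u : {ffun 'I_n -> Sigma}), is_dist (q i u).

(* The distribution described by the conditional distributions q. *)
Definition bn_of_cpt (R : realType) (n : nat) (Sigma : finType)
    (q : 'I_n -> {ffun 'I_n -> Sigma} -> Sigma -> R)
    (x : {ffun 'I_n -> Sigma}) : R :=
  \prod_(i < n) q i x (x i).

(* Main.v *)
Require Import Defs.
From HB Require Import structures.
From mathcomp Require Import all_boot all_order all_algebra.
From mathcomp Require Import ring lra zify.
From mathcomp Require Import reals sequences exp.

Set Implicit Arguments.
Unset Strict Implicit.
Unset Printing Implicit Defensive.

Import Order.TTheory GRing.Theory Num.Theory.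
Local Open Scope ring_scope.

(* The learner outputs the empirical conditional probabilities smoothed by a
   pseudo-count l of order ln (K / delta), with K = |Sigma|^(d+1) n.  A Chernoff
   bound on each of the at most K cells (vertex, parent values, symbol) shows
   that outside an event of probability at most 4 K exp (- l) every
   conditional distribution with parent probability w has chi^2 error at most
   228 |Sigma| l / (m w); smoothing by l rather than by 1 is what keeps a single
   power of ln (1 / delta) here.  The chain rule for the KL divergence weights
   this by w, so KL(P || Q) <= 228 K l / m, and dTV^2 <= KL.  As the program must
   read exactly m samples, l and m are defined as the values at which its own
   doubling and counting loops stop. *)

(** * Concentration of counts *)

(** All bounds on counts carry an additive slack [L], matched by the pseudo-count, so they need no
    lower bound on the probability w of a row. A rarely seen row only gets a poor chi^2 bound, of
    order 1/w, and its weight w cancels that; frequent and rare parent values are treated alike. The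
    constant is 228 = 222 + 6. The fluctuation of the counts and the pseudo-count in the numerator
    cost 222 per symbol. The bias from the total pseudo-count in the denominator costs 6 k p for a
    symbol of conditional probability p, hence 6 k over the k symbols of a row. Instead of an exact
    chain rule, the logarithm of the product of the ratios t of true to estimated conditional
    probabilities is bounded by the sum of the t - 1; the mean of t - 1 under P is already the
    weighted chi^2 error. The program is shaped by the machine: there is no logarithm, no rounding
    and no integer multiplication, and the preprocessing must fit into the time k^(d+1) m n as
    well. *)

Section Concentration.
Variables (R : realType) (T : finType) (P : T -> R) (m : nat).
Hypothesis Pd : is_dist P.

Lemma prodP_ge0 (s : m.-tuple T) : 0 <= \prod_(i < m) P (tnth s i).
Proof. by apply: prodr_ge0 => i _; apply: Pd.1. Qed.

(** Distributivity. With [f] the distribution itself it gives total mass 1 for m samples; with an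
    exponential weight it factors the moment generating function. *)
Lemma sum_tuple_prod (f : T -> R) :
  \sum_(s : m.-tuple T) \prod_(i < m) f (tnth s i) = (\sum_x f x) ^+ m.
Proof.
rewrite -[in RHS](card_ord m) -prodr_const bigA_distr_bigA /=.
rewrite (reindex (fun g : {ffun 'I_m -> T} => [tuple g i | i < m])) /=; last first.
  exists (fun s : m.-tuple T => [ffun i => tnth s i]) => [g _|s _].
    by apply/ffunP => i; rewrite ffunE tnth_mktuple.
  by apply: eq_from_tnth => i; rewrite tnth_mktuple ffunE.
by apply: eq_bigr => g _; apply: eq_bigr => i _; rewrite tnth_mktuple.
Qed.

Lemma iid_prob_sub (E F : pred (m.-tuple T)) :
  subpred E F -> iid_prob P E <= iid_prob P F.
Proof.
move=> sEF; rewrite /iid_prob big_mkcond [leRHS]big_mkcond /=.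
apply: ler_sum => s _; case: ifP => [/sEF -> //|_].
by case: ifP => // _; apply: prodP_ge0.
Qed.

Lemma iid_probC (E : pred (m.-tuple T)) :
  iid_prob P E = 1 - iid_prob P (predC E).
Proof.
apply/eqP; rewrite eq_sym subr_eq; apply/eqP.
by rewrite -(expr1n _ m) -Pd.2 -sum_tuple_prod (bigID E).
Qed.

Lemma iid_prob_exists (I : finType) (E : I -> pred (m.-tuple T)) :
  iid_prob P (fun s => [exists i, E i s]) <= \sum_i iid_prob P (E i).
Proof.
rewrite /iid_prob big_mkcond /=.
under [leRHS]eq_bigr do rewrite big_mkcond /=.
rewrite exchange_big /=; apply: ler_sum => s _.
have h i : 0 <= (if E i s then \prod_(j < m) P (tnth s j) else 0).
  by case: ifP => // _; apply: prodP_ge0.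
case: existsP => [[i Ei]|_]; last exact: sumr_ge0.
by rewrite (bigD1 i) //= Ei lerDl; apply: sumr_ge0.
Qed.

Lemma iid_prob_or (E F : pred (m.-tuple T)) :
  iid_prob P (fun s => E s || F s) <= iid_prob P E + iid_prob P F.
Proof.
rewrite /iid_prob 3!(big_mkcond _ (fun s => \prod_(i < m) P (tnth s i))) /=.
rewrite -big_split; apply: ler_sum => s _ /=; have := prodP_ge0 s.
by case: (E s); case: (F s) => /=; lra.
Qed.

(** Markov's inequality for the exponential of the sum: on the event the factor exp (sum - t) is at
    least 1, and its mean is a product over the samples. *)
Lemma chernoff (f : T -> R) (v t : R) :
  \sum_x P x * expR (f x) <= expR v ->
  iid_prob P (fun s : m.-tuple T => t <= \sum_(i < m) f (tnth s i))
    <= expR (m%:R * v - t).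
Proof.
move=> hv; rewrite expRD mulrC expRM_natl.
have h0 : 0 <= \sum_x P x * expR (f x).
  by apply: sumr_ge0 => x _; rewrite mulr_ge0 ?expR_ge0 ?Pd.1.
apply: (@le_trans _ _ (expR (- t) * (\sum_x P x * expR (f x)) ^+ m)); last first.
  by rewrite ler_wpM2l ?expR_ge0 // lerXn2r // nnegrE ?expR_ge0.
rewrite -sum_tuple_prod mulr_sumr /iid_prob big_mkcond /=.
apply: ler_sum => s _; rewrite big_split /= -expR_sum mulrCA -expRD.
case: ifP => [le_t|_]; last by rewrite mulr_ge0 ?prodP_ge0 ?expR_ge0.
rewrite ler_peMr ?prodP_ge0 //.
by rewrite -expR0 ler_expR addrC subr_ge0.
Qed.

End Concentration.

(** From exp (-x) >= 1 - x one gets (1 - x) exp x <= 1, while (1 - x) (1 + x + 2 x^2) = 1 + x^2 (1 -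
    2 x) >= 1 for x <= 1/2. *)
Lemma expR_le_quadratic (R : realType) (x : R) :
  `|x| <= 2^-1 -> expR x <= 1 + x + 2 * x ^+ 2.
Proof.
rewrite ler_norml => /andP[x1 x2].
have := expR_ge1Dx (- x); rewrite expRN => h.
have e0 := expR_gt0 x.
have h1 : (1 - x) * expR x <= 1.
  by rewrite -ler_pdivlMr // div1r.
have h2 : 1 <= (1 - x) * (1 + x + 2 * x ^+ 2).
  have : 0 <= x ^+ 2 * (1 - 2 * x) by rewrite mulr_ge0 ?sqr_ge0 //; lra.
  by nra.
have h3 : (1 - x) * expR x <= (1 - x) * (1 + x + 2 * x ^+ 2) by lra.
by move: h3; rewrite ler_pM2l //; lra.
Qed.

Lemma expRN1_le (R : realType) : expR (-1) <= 2^-1 :> R.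
Proof.
rewrite expRN lef_pV2 ?posrE ?expR_gt0 //.
by have := expR_ge1Dx (1 : R); lra.
Qed.

Definition pr (R : realType) (T : finType) (P : T -> R) (B : pred T) : R :=
  \sum_(x | B x) P x.

Section Counts.
Variables (R : realType) (T : finType) (P : T -> R) (m : nat).
Hypothesis Pd : is_dist P.

Lemma pr_ge0 (B : pred T) : 0 <= pr P B.
Proof. by apply: sumr_ge0 => x _; apply: Pd.1. Qed.

Lemma le_pr (B C : pred T) : subpred C B -> pr P C <= pr P B.
Proof.
move=> sCB; rewrite /pr big_mkcond [leRHS]big_mkcond; apply: ler_sum => x _.
by case: ifP => [/sCB -> //|_]; case: ifP => // _; apply: Pd.1.
Qed.

Lemma prE (B : pred T) : pr P B = \sum_x P x * (B x)%:R.
Proof.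
by rewrite /pr big_mkcond; apply: eq_bigr => x _; rewrite mulr_natr mulrb.
Qed.

Lemma countE (B : pred T) (s : m.-tuple T) :
  (count B s)%:R = \sum_(i < m) (B (tnth s i))%:R :> R.
Proof.
rewrite -sum1_count natr_sum big_mkcond big_tuple /=.
by apply: eq_bigr => i _; case: ifP.
Qed.

(** Chernoff with the weight exp (-1) <= 1/2 on each hit: its mean is at most 1 - pr/2 <= exp (-
    pr/2), so the expected count cancels and exactly [- L] remains. *)
Lemma count_lower_tail (B : pred T) (L : R) :
  iid_prob P (fun s : m.-tuple T =>
      (count B s)%:R + L <= m%:R * pr P B / 2) <= expR (- L).
Proof.
pose f x : R := - (B x)%:R.
have hv : \sum_x P x * expR (f x) <= expR (- (pr P B / 2)).
  apply: (@le_trans _ _ (\sum_x P x * (1 - (B x)%:R / 2))).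
    apply: ler_sum => x _; apply: ler_wpM2l; first exact: Pd.1.
    rewrite /f; case: (B x); rewrite /= ?mulr1n ?mulr0n.
      by have := expRN1_le R; lra.
    by rewrite oppr0 expR0; lra.
  apply: le_trans (expR_ge1Dx _); rewrite prE.
  under eq_bigr do rewrite mulrBr mulr1 mulrA.
  by rewrite sumrB -mulr_suml Pd.2.
have := chernoff m Pd (L - m%:R * pr P B / 2) hv.
have -> : m%:R * - (pr P B / 2) - (L - m%:R * pr P B / 2) = - L by ring.
apply: le_trans; apply: (iid_prob_sub Pd) => s.
by rewrite /f sumrN -countE; lra.
Qed.

Section Deviation.
Variables B C : pred T.
Hypothesis sCB : subpred C B.
Let p := pr P C / pr P B.

Let pB : p * pr P B = pr P C.
Proof.
(* Division by 0 gives 0, so an impossible [B] has p = 0, and then [C] is impossible too. *)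
have [B0|B0] := eqVneq (pr P B) 0; last by rewrite mulfVK.
have := le_pr sCB; have := pr_ge0 C; rewrite B0 mulr0; lra.
Qed.

Let p_ge0 : 0 <= p. Proof. by rewrite divr_ge0 ?pr_ge0. Qed.

Let p_le1 : p <= 1.
Proof.
have [B0|B0] := eqVneq (pr P B) 0; first by rewrite /p B0 invr0 mulr0.
by rewrite ler_pdivrMr ?mul1r ?le_pr // lt_def B0 pr_ge0.
Qed.

Let f x : R := (C x)%:R - p * (B x)%:R.

(** [f] has mean 0 and second moment (1 - p) [pr P C], so only a quadratic term proportional to
    [pr P C] survives. The coefficients in the first step expand 1 + l f + 2 (l f)^2, products of
    indicators being simplified by the inclusion of [C] in [B]. *)
Let mgf (l : R) : `|l| <= 2^-1 ->
  \sum_x P x * expR (l * f x) <= expR (2 * l ^+ 2 * pr P C).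
Proof.
move=> hl; have pl := p_ge0; have pl1 := p_le1.
have l0 : 0 <= l ^+ 2 by rewrite sqr_ge0.
apply: (@le_trans _ _ (\sum_x (P x
    + (l - 4 * l ^+ 2 * p + 2 * l ^+ 2) * (P x * (C x)%:R)
    + (2 * l ^+ 2 * p ^+ 2 - l * p) * (P x * (B x)%:R)))).
  apply: ler_sum => x _; have Px := Pd.1 x.
  have hf : `|l * f x| <= 2^-1.
    rewrite normrM; apply: le_trans hl; rewrite ler_piMr //.
    rewrite ler_norml /f; have := @sCB x.
    case: (C x); case: (B x) => //= h; rewrite ?mulr1n ?mulr0n;
      first by apply/andP; split; lra.
      by have := h isT.
    by apply/andP; split; lra.
    by apply/andP; split; lra.
  apply: (@le_trans _ _ (P x * (1 + l * f x + 2 * (l * f x) ^+ 2))).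
    by rewrite ler_wpM2l // expR_le_quadratic.
  rewrite le_eqVlt; apply/orP; left; apply/eqP; rewrite /f; have := @sCB x.
  by case: (C x); case: (B x) => //= h; rewrite ?mulr1n ?mulr0n;
    (try by have := h isT); ring.
rewrite !big_split /= -!mulr_sumr -!prE Pd.2.
apply: le_trans (expR_ge1Dx _).
have -> : (2 * l ^+ 2 * p ^+ 2 - l * p) * pr P B
    = (2 * l ^+ 2 * p - l) * pr P C by rewrite -pB; ring.
have := mulr_ge0 (mulr_ge0 l0 pl) (pr_ge0 C); nra.
Qed.

(** A Bernstein bound for the count of [C] around p times the observed count of [B]. Centring at the
    random count avoids conditioning on how often the row occurs, and the variance is governed by
    the cell, not by the row. *)
Lemma count_deviation (L : R) : 0 < L ->
  iid_prob P (fun s : m.-tuple T =>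
      9 * L * (m%:R * pr P C + L)
        < ((count C s)%:R - p * (count B s)%:R) ^+ 2) <= 2 * expR (- L).
Proof.
move=> L0; set t := m%:R * pr P C + L.
have t0 : L <= t by rewrite lerDr mulr_ge0 // pr_ge0.
have tp : 0 < t by lra.
(* The tilts are r/2 and -r/2: the quadratic term of the exponent is then at most L/2, so the
   threshold 3L/2 leaves -L. The threshold means |D| >= 3 L / r = 3 r t, whose square is 9 L t. *)
pose r := Num.sqrt (L / t).
have r0 : 0 <= r by rewrite sqrtr_ge0.
have r2 : r ^+ 2 = L / t by rewrite sqr_sqrtr // divr_ge0 //; lra.
have r2t : r ^+ 2 * t = L by rewrite r2 mulfVK // gt_eqF.
have r1 : r <= 1.
  by rewrite -(@expr_le1 _ 2) // r2 ler_pdivrMr // mul1r.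
have fE (s : m.-tuple T) l : \sum_(i < m) l * f (tnth s i)
    = l * ((count C s)%:R - p * (count B s)%:R).
  by rewrite -mulr_sumr /f sumrB -mulr_sumr -!countE.
have one_sided (l : R) : `|l| = r / 2 ->
    iid_prob P (fun s : m.-tuple T =>
      3 / 2 * L <= l * ((count C s)%:R - p * (count B s)%:R)) <= expR (- L).
  move=> hl.
  have hl2 : l ^+ 2 = r ^+ 2 / 4 by rewrite -real_normK ?num_real // hl; field.
  have := chernoff m Pd (3 / 2 * L) (@mgf l _).
  rewrite hl => /(_ ltac:(lra)) h.
  apply: le_trans (iid_prob_sub Pd _) (le_trans h _).
    by move=> s; rewrite fE.
  rewrite ler_expR hl2.
  have : r ^+ 2 * (m%:R * pr P C) <= L.
    rewrite -[leRHS]r2t; apply: ler_wpM2l; first exact: sqr_ge0.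
    by rewrite /t lerDl ltW.
  lra.
have h1 := one_sided (r / 2); have h2 := one_sided (- (r / 2)).
have hr : `|r / 2| = r / 2 by rewrite ger0_norm //; lra.
have := lerD (h1 hr) (h2 (etrans (normrN _) hr)).
have -> : expR (- L) + expR (- L) = 2 * expR (- L) by ring.
apply: le_trans; apply: le_trans (iid_prob_or Pd _ _).
apply: (iid_prob_sub Pd) => s; set D := _ - _ => hD.
have {}hD : 3 * r * t < `|D|.
  have rt0 : 0 <= 3 * r * t by rewrite !mulr_ge0 // ltW.
  rewrite -(@ltr_pXn2r _ 2) // real_normK ?num_real //.
  apply: le_lt_trans hD; rewrite -/t -{1}r2t le_eqVlt; apply/orP; left.
  by apply/eqP; ring.
have {}hD : 3 * r ^+ 2 * t <= r * `|D| by nra.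
move: hD; rewrite -mulrA r2t; case: (ger0P D) => _ hD; apply/orP.
  by left; lra.
by right; lra.
Qed.

End Deviation.
End Counts.

(** Here [w] stands for the expected count of the row, and the left side is (p - q)^2 / q. Its
    numerator splits into the sampling error and the biases [p * k * L] and [L]. Keeping the factor
    p in the second term of the bound is what makes the sum over the symbols linear in k. *)
Lemma smoothed_cell_le (R : realType) (w p k L N Na q : R) :
  0 < L -> 1 <= k -> 0 <= p -> 0 < w -> 0 <= N -> 0 <= Na ->
  (Na - p * N) ^+ 2 <= 9 * L * (w * p + L) ->
  w * p / 2 <= Na + L -> w / 2 <= N + L ->
  q = (Na + L) / (N + k * L) ->
  p ^+ 2 / q - 2 * p + q <= 222 * L / w + 6 * k * L / w * p.
Proof.
move=> L0 k1 p0 w0 N0 Na0 hd ha hu hq.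
have Lk : L <= k * L by rewrite ler_peMl // ltW.
set D := N + k * L; set E := Na + L.
have D0 : 0 < D by rewrite /D; lra.
have E0 : 0 < E by rewrite /E; lra.
have qE : p ^+ 2 / q - 2 * p + q = (p * D - E) ^+ 2 / (D * E).
  by rewrite hq -/D -/E; field; rewrite !gt_eqF.
have rE : 222 * L / w + 6 * k * L / w * p = (222 + 6 * k * p) * L / w by ring.
rewrite qE rE ler_pdivrMr ?mulr_gt0 //.
have wp0 : 0 <= w * p by rewrite mulr_ge0 // ltW.
(* Two lower bounds on the denominator: [DE1] absorbs 27 w p + 30 L, since 222/8 >= 27 and 222/4 >=
   30; [DE2] absorbs the bias (p k L)^2. *)
have DE1 : w / 2 * ((w * p + 2 * L) / 4) <= D * E.
  by apply: ler_pM; rewrite /D /E; lra.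
have DE2 : k * L * (w * p / 2) <= D * E.
  by apply: ler_pM; rewrite /D /E; lra.
have sq : (p * D - E) ^+ 2
    <= 3 * ((Na - p * N) ^+ 2 + (p * k * L) ^+ 2 + L ^+ 2).
  have -> : p * D - E = - (Na - p * N) + p * k * L - L by rewrite /D /E; ring.
  set a := Na - p * N; set b := p * k * L.
  have := sqr_ge0 (a + b); have := sqr_ge0 (a - L); have := sqr_ge0 (b + L).
  nra.
have kp0 : 0 <= k * p by rewrite mulr_ge0 //; lra.
have h2 : 6 * (k * p) * (k * L * (w * p / 2)) <= 6 * (k * p) * (D * E).
  by rewrite ler_wpM2l //; lra.
have h3 : 3 * (9 * L * (w * p + L) + (p * k * L) ^+ 2 + L ^+ 2)
    <= (222 + 6 * k * p) * L / w * (D * E).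
  have -> : (222 + 6 * k * p) * L / w * (D * E)
      = (L / w) * (222 * (D * E) + 6 * (k * p) * (D * E)) by ring.
  have -> : 3 * (9 * L * (w * p + L) + (p * k * L) ^+ 2 + L ^+ 2)
      = (L / w) * (w * (27 * (w * p) + 30 * L + 3 * (p * k) ^+ 2 * L)).
    by field; rewrite gt_eqF.
  rewrite ler_wpM2l ?divr_ge0 1?ltW //.
  have := mulr_gt0 w0 L0; have := mulr_ge0 (ltW w0) wp0; nra.
lra.
Qed.

(** * Smoothed estimates *)

Section Smoothing.
Variables (R : realType) (T U A : finType) (g : T -> U) (h : T -> A) (L : R).

Definition row_event (u : U) : pred T := fun x => g x == u.
Definition cell_event (u : U) (a : A) : pred T :=
  fun x => (g x == u) && (h x == a).

Definition smoothed (s : seq T) (u : U) (a : A) : R :=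
  ((count (cell_event u a) s)%:R + L)
    / ((count (row_event u) s)%:R + #|A|%:R * L).

Lemma sub_cell_row u a : subpred (cell_event u a) (row_event u).
Proof. by move=> x /andP[]. Qed.

Lemma sum_count_cell (s : seq T) u :
  (\sum_a count (cell_event u a) s = count (row_event u) s)%N.
Proof.
elim: s => [|x s IHs] /=; first by rewrite big1.
rewrite big_split /= IHs; congr addn; rewrite /cell_event /row_event.
case: eqP => _ /=; last by rewrite big1.
rewrite (bigD1 (h x)) //= eqxx big1 // => a; rewrite eq_sym.
by move/negbTE->.
Qed.

Hypothesis L0 : 0 < L.

Lemma smoothed_gt0 (s : seq T) u a : 0 < smoothed s u a.
Proof.
have A0 : (0 < #|A|)%N by apply/card_gt0P; exists a.
by rewrite divr_gt0 // ltr_wpDl // mulr_gt0 // ltr0n.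
Qed.

Lemma sum_smoothed (s : seq T) u : (0 < #|A|)%N -> \sum_a smoothed s u a = 1.
Proof.
move=> A0; rewrite -mulr_suml big_split /= -natr_sum sum_count_cell.
have -> : \sum_(a : A) L = #|A|%:R * L by rewrite sumr_const mulr_natl.
rewrite divff // gt_eqF // ltr_wpDl // mulr_gt0 //.
by rewrite ltr0n.
Qed.

Variables (P : T -> R) (m : nat).
Hypothesis Pd : is_dist P.

(** The negations of the three disjuncts are the hypotheses of [smoothed_cell_le]; their
    probabilities 2 + 1 + 1 give the factor 4 of the union bound. *)
Definition bad_cell (u : U) (a : A) (s : m.-tuple T) : bool :=
  let c := (count (cell_event u a) s)%:R in
  let r := (count (row_event u) s)%:R in
  let pc := pr P (cell_event u a) in
  let pr := pr P (row_event u) in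
  [|| 9 * L * (m%:R * pc + L) < (c - pc / pr * r) ^+ 2,
      c + L <= m%:R * pc / 2 | r + L <= m%:R * pr / 2].

Lemma bad_cell_prob u a : iid_prob P (bad_cell u a) <= 4 * expR (- L).
Proof.
have := lerD (count_deviation m Pd (@sub_cell_row u a) L0)
  (lerD (count_lower_tail m Pd (cell_event u a) L)
        (count_lower_tail m Pd (row_event u) L)).
have -> : 2 * expR (- L) + (expR (- L) + expR (- L)) = 4 * expR (- L) by ring.
apply: le_trans; apply: le_trans (iid_prob_or Pd _ _) _; rewrite lerD2l.
exact: iid_prob_or.
Qed.

Lemma sum_cells (F : U -> A -> R) :
  \sum_x P x * F (g x) (h x)
    = \sum_u \sum_a pr P (cell_event u a) * F u a.
Proof.
rewrite pair_bigA (partition_big (fun x => (g x, h x)) predT) //=.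
apply: eq_bigr => -[u a] _ /=; rewrite mulr_suml.
rewrite /pr (eq_bigl (cell_event u a)); last by move=> x; rewrite xpair_eqE.
by apply: eq_bigr => x /andP[/eqP-> /eqP->].
Qed.

Lemma sum_pr_cell u : \sum_a pr P (cell_event u a) = pr P (row_event u).
Proof.
rewrite [RHS](partition_big h predT) //=.
Qed.

(** Within a row the left side is w times the chi^2 error of its estimate, and [smoothed_cell_le]
    bounds that error by a multiple of 1 / (m w). The weight cancels, so every row contributes the
    same amount. *)
Lemma smoothed_chi2_le (s : m.-tuple T) :
  (0 < m)%N -> (0 < #|A|)%N -> (forall u a, ~~ bad_cell u a s) ->
  \sum_x P x * (pr P (cell_event (g x) (h x)) / pr P (row_event (g x))
                  / smoothed s (g x) (h x) - 1)
    <= (#|U| * #|A|)%N%:R * (228 * L / m%:R).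
Proof.
move=> m0 A0 good.
have mR : 0 < m%:R :> R by rewrite ltr0n.
rewrite (sum_cells (fun u a => pr P (cell_event u a) / pr P (row_event u)
  / smoothed s u a - 1)).
suff H u : \sum_a pr P (cell_event u a) *
    (pr P (cell_event u a) / pr P (row_event u) / smoothed s u a - 1)
    <= #|A|%:R * (228 * L / m%:R).
  rewrite natrM -mulrA mulr_natl -sumr_const.
  by apply: ler_sum => u _; apply: H.
set w := pr P (row_event u).
have [w0|wn0] := eqVneq w 0.
  rewrite big1 ?mulr_ge0 ?invr_ge0 ?ler0n ?ltW // => a _.
  have -> : pr P (cell_event u a) = 0; last by rewrite mul0r.
  by apply/eqP; rewrite eq_le pr_ge0 // andbT -w0 le_pr //; apply: sub_cell_row.
have w0 : 0 < w by rewrite lt_def wn0 pr_ge0.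
pose p a := pr P (cell_event u a) / w.
have p0 a : 0 <= p a by rewrite divr_ge0 ?pr_ge0 // ltW.
have sp : \sum_a p a = 1 by rewrite -mulr_suml sum_pr_cell divff.
(* Both p and q sum to 1, so p^2/q - p may be replaced by p^2/q - 2p + q, which is (p - q)^2 / q
   term by term. *)
have -> : \sum_a pr P (cell_event u a) * (pr P (cell_event u a) / w / smoothed s u a - 1)
    = w * \sum_a (p a ^+ 2 / smoothed s u a - 2 * p a + smoothed s u a).
  have -> : \sum_a (p a ^+ 2 / smoothed s u a - 2 * p a + smoothed s u a)
     = \sum_a (p a ^+ 2 / smoothed s u a - p a).
    rewrite big_split /= sumrB -mulr_sumr sp sum_smoothed // sumrB sp; ring.
  rewrite mulr_sumr; apply: eq_bigr => a _; rewrite /p.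
  by field; rewrite wn0 gt_eqF ?smoothed_gt0.
have cell a : p a ^+ 2 / smoothed s u a - 2 * p a + smoothed s u a
   <= 222 * L / (m%:R * w) + 6 * #|A|%:R * L / (m%:R * w) * p a.
  have := good u a; rewrite !negb_or -!ltNge -leNgt => /and3P[g1 g2 g3].
  have wp : m%:R * w * p a = m%:R * pr P (cell_event u a).
    by rewrite /p; field.
  apply: (smoothed_cell_le (N := (count (row_event u) s)%:R)
    (Na := (count (cell_event u a) s)%:R)) => //.
  - by rewrite ler1n.
  - by rewrite mulr_gt0.
  - by rewrite wp.
  - by rewrite wp ltW.
  - by rewrite ltW.
apply: (@le_trans _ _ (w * (#|A|%:R * (228 * L / (m%:R * w))))).
  apply: ler_wpM2l; first exact: ltW.
  apply: (@le_trans _ _ (\sum_a (222 * L / (m%:R * w)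
      + 6 * #|A|%:R * L / (m%:R * w) * p a))).
    by apply: ler_sum => a _; apply: cell.
  rewrite big_split /=.
  rewrite (_ : \sum_(a : A) 222 * L / (m%:R * w)
      = #|A|%:R * (222 * L / (m%:R * w))); last first.
  move: (222 * L / _) => z.
  by rewrite sumr_const mulr_natl.
  by rewrite -mulr_sumr sp le_eqVlt; apply/orP; left; apply/eqP; ring.
by rewrite le_eqVlt; apply/orP; left; apply/eqP; field; rewrite wn0 gt_eqF.
Qed.

End Smoothing.

(* With [y = sqrt P], [z = sqrt Q] and [H = \sum (y - z)^2], the inequality
   [ln t <= t - 1] at [t = z / y] gives [H <= KL(P || Q)], and Cauchy-Schwarz
   on [|P - Q| = |y - z| (y + z)] gives [dTV^2 <= H]. *)
Lemma dTV_sqr_le_KL (R : realType) (T : finType) (P Q : T -> R) :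
  is_dist P -> is_dist Q -> (forall x, 0 < Q x) ->
  dTV P Q ^+ 2 <= \sum_x P x * ln (P x / Q x).
Proof.
move=> Pd Qd Q0; pose y x := Num.sqrt (P x); pose z x := Num.sqrt (Q x).
have y0 x : 0 <= y x by rewrite sqrtr_ge0.
have z0 x : 0 < z x by rewrite sqrtr_gt0.
have yE x : y x ^+ 2 = P x by rewrite sqr_sqrtr // Pd.1.
have zE x : z x ^+ 2 = Q x by rewrite sqr_sqrtr // Qd.1.
pose B := \sum_x y x * z x.
have sP : \sum_x y x ^+ 2 = 1 by rewrite -Pd.2; apply: eq_bigr.
have sQ : \sum_x z x ^+ 2 = 1 by rewrite -Qd.2; apply: eq_bigr.
have HE : \sum_x (y x - z x) ^+ 2 = 2 - 2 * B.
  rewrite (eq_bigr (fun x => y x ^+ 2 + z x ^+ 2 - 2 * (y x * z x))).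
    by rewrite sumrB big_split /= sP sQ -mulr_sumr.
  by move=> x _; ring.
have SE : \sum_x (y x + z x) ^+ 2 = 2 + 2 * B.
  rewrite (eq_bigr (fun x => y x ^+ 2 + z x ^+ 2 + 2 * (y x * z x))).
    by rewrite !big_split /= sP sQ -mulr_sumr.
  by move=> x _; ring.
have B1 : B <= 1.
  have : 0 <= \sum_x (y x - z x) ^+ 2 by apply: sumr_ge0 => x _; exact: sqr_ge0.
  by rewrite HE; lra.
apply: (@le_trans _ _ (2 - 2 * B)); last first.
  have -> : 2 - 2 * B = \sum_x 2 * (y x ^+ 2 - y x * z x).
    by rewrite -mulr_sumr sumrB sP /B; ring.
  apply: ler_sum => x _; rewrite -yE -zE -expr_div_n.
  have [->|yn0] := eqVneq (y x) 0; first by rewrite expr0n /= !mul0r subrr mulr0.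
  have yp : 0 < y x by rewrite lt_def yn0 y0.
  rewrite lnXn ?divr_gt0 // -(invrK (y x / z x)) lnV ?posrE ?invr_gt0 ?divr_gt0 //.
  rewrite invf_div.
  have := le_ln1Dx (x := z x / y x - 1).
  have : 0 < z x / y x by rewrite divr_gt0.
  move=> t0 /(_ ltac:(lra)); rewrite (addrC 1) subrK => hl.
  have yz : y x * z x = y x ^+ 2 * (z x / y x) by field.
  rewrite yz -mulr_natl.
  have : 0 < y x ^+ 2 by rewrite exprn_gt0.
  nra.
set D := \sum_x `|P x - Q x|.
have D0 : 0 <= D by apply: sumr_ge0.
(* Cauchy-Schwarz in its arithmetic-geometric form, with the weight t left free. *)
have hD t : 0 < t -> 2 * D <= t * (2 + 2 * B) + t^-1 * (2 - 2 * B).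
  move=> t0; rewrite -HE -SE !mulr_sumr -big_split; apply: ler_sum => x _ /=.
  have -> : `|P x - Q x| = `|y x - z x| * (y x + z x).
    rewrite -[in RHS](ger0_norm (ltW (ltr_wpDl (y0 x) (z0 x)))) -normrM.
    by rewrite -yE -zE; congr `|_|; ring.
  rewrite -[X in _ + _ * X]real_normK ?num_real //.
  set a := `|_|; set b := y x + z x.
  have : 0 <= t^-1 * (a - t * b) ^+ 2.
    by rewrite mulr_ge0 ?sqr_ge0 // invr_ge0 ltW.
  have -> : t^-1 * (a - t * b) ^+ 2 = t * b ^+ 2 + t^-1 * a ^+ 2 - 2 * (a * b).
    by field; rewrite gt_eqF.
  lra.
have -> : dTV P Q ^+ 2 = D ^+ 2 / 4 by rewrite /dTV -/D; field.
have [D00|Dn0] := eqVneq D 0; first by rewrite D00; lra.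
have Dp : 0 < D by rewrite lt_def Dn0 D0.
(* As B <= 1, the first term is at most 4 t = D for this t, which leaves D^2 <= 4 (2 - 2 B). *)
have := hD (D / 4); rewrite divr_gt0 // => /(_ isT).
move/(ler_wpM2r D0).
have -> : (D / 4 * (2 + 2 * B) + (D / 4)^-1 * (2 - 2 * B)) * D
    = D / 4 * (2 + 2 * B) * D + 4 * (2 - 2 * B) by field.
nra.
Qed.

(** * Factorization of Bayesian networks *)

Section DownClosed.
Variables (n : nat) (G : rel 'I_n).
Hypothesis acG : acyclic G.

(** Growing such sets one vertex at a time replaces a topological order. *)
Definition down_closed (S : {set 'I_n}) : Prop :=
  forall i j : 'I_n, j \in S -> G i j -> i \in S.

Definition ancestors (i : 'I_n) : {set 'I_n} := [set j | connect G j i].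

Lemma ancestors_proper (i j : 'I_n) :
  G i j -> (#|ancestors i| < #|ancestors j|)%N.
Proof.
move=> Gij; apply: proper_card; apply/properP; split.
  apply/subsetP => l; rewrite !inE => li.
  exact: connect_trans li (connect1 Gij).
by exists j; rewrite !inE ?connect0 // acG.
Qed.

(* A missing vertex with the fewest ancestors has all its parents in [S]. *)
Lemma down_closed_extend (S : {set 'I_n}) : down_closed S -> S != setT ->
  exists i, [/\ i \notin S, down_closed (i |: S) & parents G i \subset S].
Proof.
move=> dS; rewrite -subTset => /subsetPn[j0 _ j0S].
case: (@arg_minnP _ j0 (fun i => i \notin S) (fun i => #|ancestors i|)) => //.
move=> i iS imin.
have pi l : G l i -> l \in S.
  move=> Gli; apply: contraT => /imin.
  by rewrite leqNgt (ancestors_proper Gli).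
exists i; split=> // [l j|]; last by apply/subsetP => l; rewrite inE => /pi.
rewrite !inE => /orP[/eqP->/pi->|jS Glj]; first by rewrite orbT.
by rewrite (dS _ _ jS Glj) orbT.
Qed.

Lemma down_closed_nondescendants (i : 'I_n) :
  down_closed (nondescendants G i).
Proof.
move=> l j; rewrite !inE => ij Glj; apply: contra ij => il.
exact: connect_trans il (connect1 Glj).
Qed.

Lemma parents_nondescendants (i : 'I_n) :
  parents G i \subset nondescendants G i.
Proof. by apply/subsetP => j; rewrite !inE => /acG. Qed.

Lemma down_closed_nondescendantsU1 (i : 'I_n) :
  down_closed (i |: nondescendants G i).
Proof.
move=> l j; rewrite in_setU1 => /orP[/eqP->|jS] Glj; rewrite in_setU1.
  have /subsetP/(_ l) := parents_nondescendants i.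
  by rewrite inE Glj => /(_ isT)->; rewrite orbT.
by rewrite (down_closed_nondescendants jS Glj) orbT.
Qed.

Lemma down_closed_sub_nondescendants (S : {set 'I_n}) (i : 'I_n) :
  down_closed S -> i \notin S -> S \subset nondescendants G i.
Proof.
move=> dS iS; apply/subsetP => j jS; rewrite inE; apply: contra iS.
case/connectP => p; elim: p i => [|l p IHp] i /=; first by move=> _ <-.
by case/andP=> Gil /IHp h /h lS; apply: dS lS Gil.
Qed.

End DownClosed.

Section Marginals.
Variables (R : realType) (n : nat) (Sigma : finType).
Implicit Types (P : {ffun 'I_n -> Sigma} -> R) (x y z : {ffun 'I_n -> Sigma}).
Implicit Types S C : {set 'I_n}.

Definition agree S x y := [forall j in S, y j == x j].

Lemma agreeP S x y : reflect {in S, x =1 y} (agree S x y).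
Proof.
apply: (iffP forall_inP) => [h j /h/eqP-> //|h j /h->]; exact: eqxx.
Qed.

Definition setx x (i : 'I_n) (a : Sigma) : {ffun 'I_n -> Sigma} :=
  [ffun j => if j == i then a else x j].

Lemma setxE x i a : setx x i a i = a.
Proof. by rewrite ffunE eqxx. Qed.

Lemma setx_neq x i a j : j != i -> setx x i a j = x j.
Proof. by rewrite ffunE => /negbTE->. Qed.

Lemma eq_marg P S x y : {in S, x =1 y} -> marg P S x = marg P S y.
Proof.
move=> h; apply: eq_bigl => z; apply/agreeP/agreeP => g j jS.
  by rewrite -h // g.
by rewrite h // g.
Qed.

Lemma marg_ge0 P S x : is_dist P -> 0 <= marg P S x.
Proof. by move=> Pd; apply: sumr_ge0 => y _; apply: Pd.1. Qed.

Lemma margT P x : marg P setT x = P x.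
Proof.
rewrite /marg (big_pred1 x) // => y; apply/agreeP/eqP => [h|->] //.
by apply/ffunP => j; rewrite h ?inE.
Qed.

Lemma marg0 P x : marg P set0 x = \sum_y P y.
Proof. by apply: eq_bigl => y; apply/agreeP => j; rewrite inE. Qed.

Lemma marg_sum1 P S x i : i \notin S ->
  marg P S x = \sum_a marg P (i |: S) (setx x i a).
Proof.
move=> iS; rewrite {1}/marg (partition_big (fun y => y i) predT) //=.
apply: eq_bigr => a _; apply: eq_bigl => y.
have neq j : j \in S -> j != i by apply: contraTneq => ->.
apply/andP/agreeP => [[/agreeP h /eqP ya] j|h].
  rewrite in_setU1 => /orP[/eqP->|jS]; first by rewrite setxE.
  by rewrite setx_neq ?neq // h.
split; last by rewrite -h ?setxE // setU11.
by apply/agreeP => j jS; rewrite -h ?setx_neq ?neq // setU1r.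
Qed.

Lemma le_marg P S C x : is_dist P -> S \subset C -> marg P C x <= marg P S x.
Proof.
move=> Pd /subsetP sSC; apply: (le_pr Pd) => y /agreeP h.
by apply/agreeP => j /sSC/h.
Qed.

End Marginals.

Section Factorization.
Variables (R : realType) (n : nat) (Sigma : finType) (G : rel 'I_n).
Hypothesis acG : acyclic G.
Implicit Types (P : {ffun 'I_n -> Sigma} -> R) (x y z : {ffun 'I_n -> Sigma}).
Implicit Types S C D : {set 'I_n}.

(** The vertices of [D] outside [C] are summed out one by one; [c] does not see them and comes out
    of each sum. This transfers the conditional law of i from its non-descendants to any smaller set
    that determines [c]. *)
Lemma marg_factor P C D i (c : {ffun 'I_n -> Sigma} -> R) :
  (forall x y, {in i |: C, x =1 y} -> c x = c y) ->
  i \notin D -> C \subset D ->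
  (forall x, marg P (i |: D) x = c x * marg P D x) ->
  forall x, marg P (i |: C) x = c x * marg P C x.
Proof.
move=> cC; have [l] := ubnP #|D :\: C|.
elim: l D => // l IHl D; rewrite ltnS => le_l iD sCD hD.
have [|/set0Pn[j]] := boolP (D :\: C == set0).
  rewrite setD_eq0 => sDC; suff -> : C = D by [].
  by apply/eqP; rewrite eqEsubset sCD.
rewrite inE => /andP[jC jD].
have ij : j != i by apply: contraNneq iD => <-.
have DE : D = j |: D :\ j by rewrite setD1K.
apply: (IHl (D :\ j)).
- apply: leq_trans le_l; apply: proper_card; apply/properP; split.
    by apply: setSD; apply: subD1set.
  by exists j; rewrite !inE ?jC ?jD // eqxx andbF.
- by rewrite !inE negb_and iD orbT.
- by apply/subsetD1P.
move=> x; rewrite (@marg_sum1 _ _ _ _ (i |: D :\ j) x j); last first.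
  by rewrite !inE eqxx (negbTE ij).
rewrite (@marg_sum1 _ _ _ _ (D :\ j) x j) ?setD11 //.
rewrite -DE mulr_sumr; apply: eq_bigr => a _.
rewrite setUCA -DE hD (cC (setx x j a) x) // => t; rewrite !inE => it.
rewrite setx_neq //; case/orP: it => [/eqP->|]; first by rewrite eq_sym.
by apply: contraTneq => ->.
Qed.

Section Bayesnet.
Variable P : {ffun 'I_n -> Sigma} -> R.
Hypothesis bP : is_bayesnet G P.

Definition local_cprob i x := cprob P [set i] (parents G i) x.

(** Conditional independence with denominators cleared. It says nothing where the parent values have
    probability 0, but there both marginals vanish. *)
Lemma marg_nondescendantsU1 i x :
  marg P (i |: nondescendants G i) x
    = local_cprob i x * marg P (nondescendants G i) x.
Proof.
have [Pd cind] := bP.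
have sub := parents_nondescendants acG i.
have [w0|wn0] := eqVneq (marg P (parents G i) x) 0.
  have z S : parents G i \subset S -> marg P S x = 0.
    move=> /(le_marg x Pd); rewrite w0 => le0.
    by apply/eqP; rewrite eq_le le0 marg_ge0.
  by rewrite !z ?mulr0 // (subset_trans sub) // subsetUr.
have w0 : 0 < marg P (parents G i) x by rewrite lt_def wn0 marg_ge0.
have := cind i x w0; rewrite /cprob -setUA (setUidPl sub).
move/(congr1 (fun t => t * marg P (parents G i) x)).
by rewrite mulfVK // -mulrA mulfVK.
Qed.

Lemma bayesnet_factorization x : P x = \prod_i local_cprob i x.
Proof.
have [Pd _] := bP.
(* The induction runs from all vertices, where the product is empty, down to the empty set, where
   the marginal is 1. *)
have step S : down_closed G S ->
    P x = marg P S x * \prod_(i | i \notin S) local_cprob i x.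
  have [l] := ubnP #|~: S|; elim: l S => // l IHl S; rewrite ltnS => le_l dS.
  have [->|ST] := eqVneq S setT.
    by rewrite margT big1 ?mulr1 // => i; rewrite inE.
  have [i [iS diS piS]] := down_closed_extend acG dS ST.
  rewrite (IHl (i |: S)) //; last first.
    apply: leq_trans le_l; apply: proper_card; apply/properP; split.
      by rewrite setCS subsetUr.
    by exists i; rewrite !inE ?iS // eqxx.
  rewrite (@marg_factor P S (nondescendants G i) i (local_cprob i)).
  - rewrite [in RHS](bigD1 i) //= mulrCA mulrA; congr (_ * _).
    by apply: eq_bigl => j; rewrite !inE negb_or andbC.
  - move=> y z yz; rewrite /local_cprob /cprob.
    congr (_ / _); apply: eq_marg => j jp; apply: yz.
      by move: jp; rewrite !in_setU => /orP[->//|/(subsetP piS)->]; rewrite orbT.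
    by rewrite in_setU (subsetP piS) ?orbT.
  - by rewrite inE connect0.
  - exact: down_closed_sub_nondescendants.
  - exact: marg_nondescendantsU1.
rewrite (step set0) => [|i j]; last by rewrite inE.
by rewrite marg0 Pd.2 mul1r; apply: eq_bigl => i; rewrite inE.
Qed.

End Bayesnet.

Section ConditionalTables.
Variables (q : 'I_n -> {ffun 'I_n -> Sigma} -> Sigma -> R).
Hypothesis qc : is_cpt q.
(** Tables are indexed by full assignments; this restricts their dependence to the parents. *)
Hypothesis ql : forall i x y, {in parents G i, x =1 y} -> q i x =1 q i y.

(** A vertex added to [S] with all its parents in [S] is summed out: its own factor sums to 1, and
    no factor of a vertex in the down-closed [S] reads its value. *)
Lemma marg_bn_of_cpt S x : down_closed G S ->
  marg (bn_of_cpt q) S x = \prod_(i in S) q i x (x i).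
Proof.
have [l] := ubnP #|~: S|; elim: l S x => // l IHl S x; rewrite ltnS => le_l dS.
have [->|ST] := eqVneq S setT.
  by rewrite margT; apply: eq_bigl => i; rewrite inE.
have [i [iS diS /subsetP piS]] := down_closed_extend acG dS ST.
have neq j : j \in S -> j != i by apply: contraTneq => ->.
have -> : \prod_(j in S) q j x (x j)
    = \sum_a q i x a * \prod_(j in S) q j x (x j).
  by rewrite -mulr_suml (qc i x).2 mul1r.
rewrite (marg_sum1 _ _ iS).
apply: eq_bigr => a _; rewrite IHl //; last first.
  apply: leq_trans le_l; apply: proper_card; apply/properP; split.
    by rewrite setCS subsetUr.
  by exists i; rewrite !inE ?iS // eqxx.
rewrite big_setU1 //= setxE; congr (_ * _).
  by apply: ql => j /piS/neq jn; rewrite setx_neq.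
apply: eq_bigr => j jS; rewrite setx_neq ?neq //.
apply: ql => t; rewrite inE => /(dS _ _ jS)/neq tn; exact: setx_neq.
Qed.

Lemma bn_of_cpt_dist (x0 : {ffun 'I_n -> Sigma}) : is_dist (bn_of_cpt q).
Proof.
split=> [x|]; first by apply: prodr_ge0 => i _; apply: (qc i x).1.
rewrite -(marg0 _ x0) marg_bn_of_cpt ?big_set0 // => i j.
by rewrite inE.
Qed.

(** The table entry multiplies the marginal of the non-descendants, and by [marg_factor] that of the
    parents too; so it is the conditional probability given either set. *)
Lemma bn_of_cpt_bayesnet (x0 : {ffun 'I_n -> Sigma}) :
  is_bayesnet G (bn_of_cpt q).
Proof.
split=> [|i x w0]; first exact: bn_of_cpt_dist.
have sub := parents_nondescendants acG i.
have ind : i \notin nondescendants G i by rewrite inE connect0.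
have hN y : marg (bn_of_cpt q) (i |: nondescendants G i) y
    = q i y (y i) * marg (bn_of_cpt q) (nondescendants G i) y.
  rewrite !marg_bn_of_cpt ?big_setU1 //.
    exact: down_closed_nondescendants.
  exact: down_closed_nondescendantsU1.
rewrite /cprob -setUA (setUidPl sub) hN.
rewrite (@marg_factor _ _ _ i (fun y => q i y (y i)) _ ind sub hN) => [|y z yz].
  by rewrite mulfK ?mulrA // gt_eqF.
rewrite yz ?setU11 //; apply: ql => j jp; apply: yz.
by rewrite setU1r.
Qed.

End ConditionalTables.
End Factorization.

(** * Accuracy of the estimator *)

Section Estimator.
Variables (R : realType) (n : nat) (Sigma : finType) (G : rel 'I_n).

(** Rows are indexed by assignments to the parents alone, so that only |Sigma|^(#parents) of them
    enter the union bound. *)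
Definition parent_values (i : 'I_n) (x : {ffun 'I_n -> Sigma}) :
    {ffun 'I_#|parents G i| -> Sigma} :=
  [ffun t => x (enum_val t)].

Definition estimator (L : R) (s : seq {ffun 'I_n -> Sigma}) (i : 'I_n)
    (u : {ffun 'I_n -> Sigma}) (a : Sigma) : R :=
  smoothed (parent_values i) (fun x => x i) L s (parent_values i u) a.

Lemma eq_parent_values i (x y : {ffun 'I_n -> Sigma}) :
  (parent_values i x == parent_values i y) = agree (parents G i) y x.
Proof.
apply/eqP/agreeP => [h j jp|h].
  have := congr1 (fun f : {ffun _ -> _} => f (enum_rank_in jp j)) h.
  by rewrite !ffunE enum_rankK_in.
by apply/ffunP => t; rewrite !ffunE -h // enum_valP.
Qed.

Lemma estimator_local L s i (x y : {ffun 'I_n -> Sigma}) :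
  {in parents G i, x =1 y} -> estimator L s i x =1 estimator L s i y.
Proof.
move=> xy a; rewrite /estimator; suff -> : parent_values i x = parent_values i y by [].
by apply/eqP; rewrite eq_parent_values; apply/agreeP => j /xy.
Qed.

Lemma estimator_gt0 L s i u a : 0 < L -> 0 < estimator L s i u a.
Proof. by move=> L0; apply: smoothed_gt0. Qed.

Lemma estimator_cpt L s : 0 < L -> is_cpt (estimator L s).
Proof.
move=> L0 i u; split=> [a|]; first by rewrite ltW ?estimator_gt0.
by apply: sum_smoothed => //; apply/card_gt0P; exists (u i).
Qed.

Lemma local_cprobE (P : {ffun 'I_n -> Sigma} -> R) i x :
  local_cprob G P i x
    = pr P (cell_event (parent_values i) (fun y => y i) (parent_values i x) (x i))
      / pr P (row_event (parent_values i) (parent_values i x)).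
Proof.
rewrite /local_cprob /cprob; congr (_ / _); apply: eq_bigl => y; last first.
  by rewrite /row_event eq_parent_values; apply/agreeP/agreeP => h j /h.
rewrite /cell_event eq_parent_values.
apply/forall_inP/andP => [h|[/agreeP h /eqP yi] j].
  split; last by apply: h; rewrite setU11.
  by apply/agreeP => j jp; rewrite (eqP (h j _)) // setU1r.
by rewrite in_setU1 => /orP[/eqP->|/h->]; apply/eqP.
Qed.

Hypothesis acG : acyclic G.
Variables (d m : nat) (L : R) (P : {ffun 'I_n -> Sigma} -> R).
Hypothesis indeg : forall i : 'I_n, (#|parents G i| <= d)%N.
Hypothesis Sigma0 : (0 < #|Sigma|)%N.
Hypothesis m0 : (0 < m)%N.
Hypothesis L0 : 0 < L.
Hypothesis bP : is_bayesnet G P.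

Let K : R := (#|Sigma| ^ d.+1 * n)%N%:R.

Let cells_le (c : R) : 0 <= c ->
  \sum_(i < n) (#|{ffun 'I_#|parents G i| -> Sigma}| * #|Sigma|)%N%:R * c
    <= K * c.
Proof.
move=> c0; rewrite -mulr_suml ler_wpM2r // -natr_sum ler_nat.
rewrite mulnC -[X in (_ <= X * _)%N]card_ord -sum_nat_const.
apply: leq_sum => i _; rewrite card_ffun card_ord expnSr leq_mul2r.
by rewrite leq_pexp2l ?orbT.
Qed.

(** Proved after exponentiation, factor by factor from t <= exp (t - 1). *)
Let ln_prod_le (t : 'I_n -> R) : (forall i, 0 <= t i) -> 0 < \prod_i t i ->
  ln (\prod_i t i) <= \sum_i (t i - 1).
Proof.
move=> t0 tp; rewrite -ler_expR lnK // expR_sum.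
apply: ler_prod => i _; rewrite t0 /=.
by have := expR_ge1Dx (t i - 1); rewrite addrC subrK.
Qed.

Let bad (s : m.-tuple {ffun 'I_n -> Sigma}) : bool :=
  [exists i : 'I_n, [exists u, [exists a,
    bad_cell (parent_values i) (fun x => x i) L P u a s]]].

Let bad_prob : iid_prob P bad <= K * (4 * expR (- L)).
Proof.
have [Pd _] := bP.
apply: le_trans (cells_le _); last by rewrite mulr_ge0 ?expR_ge0.
apply: le_trans (iid_prob_exists Pd _) _; apply: ler_sum => i _.
rewrite natrM -mulrA mulr_natl -sumr_const.
apply: le_trans (iid_prob_exists Pd _) _; apply: ler_sum => u _.
rewrite mulr_natl -sumr_const.
apply: le_trans (iid_prob_exists Pd _) _; apply: ler_sum => a _.
exact: bad_cell_prob.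
Qed.

(** [ln_prod_le] splits the log-likelihood ratio into one term per vertex; averaged over P, each
    term is the quantity bounded by [smoothed_chi2_le]. *)
Let good_dTV s : ~~ bad s ->
  dTV P (bn_of_cpt (estimator L s)) ^+ 2 <= K * (228 * L / m%:R).
Proof.
move=> good; have [Pd _] := bP.
have /card_gt0P[a0 _] := Sigma0.
pose x0 : {ffun 'I_n -> Sigma} := [ffun=> a0].
have Qd := bn_of_cpt_dist acG (estimator_cpt s L0) (@estimator_local L s) x0.
have Q0 x : 0 < bn_of_cpt (estimator L s) x.
  by apply: prodr_gt0 => i _; apply: estimator_gt0.
have c0 i x : 0 <= local_cprob G P i x by rewrite divr_ge0 ?marg_ge0.
apply: le_trans (dTV_sqr_le_KL Pd Qd Q0) _.
apply: (@le_trans _ _ (\sum_x P x * \sum_i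
    (local_cprob G P i x / estimator L s i x (x i) - 1))).
  apply: ler_sum => x _; have [->|Pn0] := eqVneq (P x) 0; first by rewrite !mul0r.
  have Px : 0 < P x by rewrite lt_def Pn0 Pd.1.
  rewrite ler_wpM2l ?Pd.1 //.
  have e : P x / bn_of_cpt (estimator L s) x
      = \prod_i (local_cprob G P i x / estimator L s i x (x i)).
    by rewrite prodf_div -(bayesnet_factorization acG bP).
  rewrite e; apply: ln_prod_le => [i|]; last by rewrite -e divr_gt0.
  by rewrite divr_ge0 // ltW // estimator_gt0.
under eq_bigr do rewrite mulr_sumr.
rewrite exchange_big /=.
apply: le_trans (cells_le _); last by rewrite !mulr_ge0 ?invr_ge0 // ltW.
apply: ler_sum => i _.
under eq_bigr do rewrite local_cprobE.
apply: (smoothed_chi2_le (g := parent_values i) (h := fun x => x i)) => // u a.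
by apply: contra good => b; apply/existsP; exists i; apply/existsP; exists u;
  apply/existsP; exists a.
Qed.

Lemma estimator_dTV (eps delta : R) :
  0 <= eps -> 4 * K <= delta * expR L -> 228 * K * L <= m%:R * eps ^+ 2 ->
  1 - delta <= iid_prob P (fun s : m.-tuple {ffun 'I_n -> Sigma} =>
    dTV P (bn_of_cpt (estimator L s)) <= eps).
Proof.
move=> e0 hL hm; have [Pd _] := bP.
have mR : 0 < m%:R :> R by rewrite ltr0n.
rewrite (iid_probC Pd) lerD2l lerN2.
apply: (@le_trans _ _ (iid_prob P bad)).
  apply: (iid_prob_sub Pd) => s; apply: contraR => /good_dTV h.
  have dTV0 : 0 <= dTV P (bn_of_cpt (estimator L s)).
    by rewrite mulr_ge0 ?invr_ge0 // sumr_ge0.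
  rewrite -(@ler_pXn2r _ 2) //; apply: le_trans h _.
  by rewrite mulrA ler_pdivrMr // [X in _ <= X]mulrC; lra.
apply: le_trans bad_prob _; rewrite expRN mulrA ler_pdivrMr ?expR_gt0 //; lra.
Qed.

End Estimator.

(** * The program and its running time *)

Section RunLogic.
Variable R : realType.
Implicit Types (st : state R) (c : cmd) (b : bexp) (Q : state R -> Prop).

(** Total correctness with a time bound: halting is part of the claim. *)
Definition runs c st (B : nat) Q : Prop :=
  exists t st', [/\ exec c st t st', (t <= B)%N & Q st'].

Lemma runs_le c st B B' Q Q' :
  runs c st B Q -> (B <= B')%N -> (forall st', Q st' -> Q' st') ->
  runs c st B' Q'.
Proof.
move=> [t [st' [h tB q]]] BB' QQ'; exists t, st'; split=> //; last exact: QQ'.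
exact: leq_trans tB BB'.
Qed.

Lemma runs_leB c st B B' Q : runs c st B Q -> (B <= B')%N -> runs c st B' Q.
Proof. by move=> h hB; apply: runs_le h hB _. Qed.

Lemma runs_skip st Q : Q st -> runs Skip st 1 Q.
Proof. by move=> q; exists 1%N, st; split=> //; apply: ExecSkip. Qed.

Lemma runs_iset a e1 e2 st Q :
  Q (State (upd (imem st) a (ieval st e1) (ieval st e2)) (rmem st)
       (pending st)) ->
  runs (ISet a e1 e2) st (icost e1 + icost e2).+1 Q.
Proof. by move=> q; do 2!eexists; split; [apply: ExecISet|apply: leqnn|]. Qed.

Lemma runs_rset a e1 e2 st Q :
  Q (State (imem st) (upd (rmem st) a (ieval st e1) (reval st e2))
       (pending st)) ->
  runs (RSet a e1 e2) st (icost e1 + rcost e2).+1 Q.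
Proof. by move=> q; do 2!eexists; split; [apply: ExecRSet|apply: leqnn|]. Qed.

Lemma runs_sample a st x xs Q : pending st = x :: xs ->
  Q (State (upd_seq (imem st) a x) (rmem st) xs) ->
  runs (Sample a) st (size x).+1 Q.
Proof.
case: st => I M p /= -> q.
by do 2!eexists; split; [apply: ExecSample|apply: leqnn|].
Qed.

Lemma runs_seq c1 c2 st B1 B2 Q :
  runs c1 st B1 (fun st1 => runs c2 st1 B2 Q) ->
  runs (Seq c1 c2) st (B1 + B2) Q.
Proof.
move=> [t1 [st1 [h1 l1 [t2 [st2 [h2 l2 q]]]]]].
exists (t1 + t2)%N, st2; split=> //; first exact: ExecSeq h1 h2.
exact: leq_add.
Qed.

Lemma runs_if b c1 c2 st B Q :
  (beval st b -> runs c1 st B Q) -> (~~ beval st b -> runs c2 st B Q) ->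
  runs (If b c1 c2) st (bcost b + B).+1 Q.
Proof.
move=> h1 h2.
have [t [st' [h l q]]] : runs (if beval st b then c1 else c2) st B Q.
  by case: ifP => [/h1|/negbT/h2].
exists (bcost b + t).+1, st'; split=> //; first exact: ExecIf.
by rewrite ltnS leq_add2l.
Qed.

Lemma runs_for b c (Inv : nat -> state R -> Prop) N B st :
  Inv 0%N st ->
  (forall j st, (j < N)%N -> Inv j st -> beval st b /\ runs c st B (Inv j.+1)) ->
  (forall st, Inv N st -> ~~ beval st b) ->
  runs (While b c) st ((bcost b + B).+1 * N + (bcost b).+1) (Inv N).
Proof.
move=> h0 hS hN.
suff H r j st' : (j + r = N)%N -> Inv j st' ->
    runs (While b c) st' ((bcost b + B).+1 * r + (bcost b).+1) (Inv N).
  exact: H (add0n N) h0.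
elim: r j st' => [|r IHr] j st' jr hj.
  rewrite addn0 in jr; rewrite jr in hj; rewrite muln0 add0n.
  by exists (bcost b).+1, st'; split=> //; apply: ExecWhileF; apply: hN.
have jN : (j < N)%N by rewrite -jr addnS ltnS leq_addr.
have [hb [t1 [st1 [e1 l1 q1]]]] := hS _ _ jN hj.
have [|t2 [st2 [e2 l2 q2]]] := IHr j.+1 st1 _ q1; first by rewrite addSnnS.
exists (bcost b + t1 + t2).+1, st2; split=> //; first exact: ExecWhileT hb e1 e2.
rewrite mulnS; lia.
Qed.

End RunLogic.

Definition frame (T : Type) (s : seq nat) (M M' : nat -> nat -> T) : Prop :=
  forall a j, a \notin s -> M' a j = M a j.

Section Frame.
Variable T : Type.
Implicit Types (s : seq nat) (M : nat -> nat -> T).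

Lemma frame_upd s M M' a j v :
  a \in s -> frame s M M' -> frame s M (upd M' a j v).
Proof.
move=> aS h b l bS; rewrite /upd; case: eqP => [ba|_]; last exact: h.
by rewrite ba aS in bS.
Qed.

Lemma frame_trans s s1 s2 M1 M2 M3 :
  frame s1 M1 M2 -> frame s2 M2 M3 -> {subset s1 <= s} -> {subset s2 <= s} ->
  frame s M1 M3.
Proof.
move=> h1 h2 ss1 ss2 a j aS; rewrite h2 ?h1 //.
  by apply: contra aS => /ss1.
by apply: contra aS => /ss2.
Qed.

End Frame.

Lemma frame_upd_seq s (M M' : nat -> nat -> nat) a v :
  a \in s -> frame s M M' -> frame s M (upd_seq M' a v).
Proof.
move=> aS h b l bS; rewrite /upd_seq; case: eqP => [ba|_]; last exact: h.
by rewrite ba aS in bS.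
Qed.

(** * The learner as a real-RAM program *)

Local Notation "c1 ;; c2" := (Seq c1 c2) (at level 100, right associativity).
Local Notation ivar a := (IGet a (INum 0)).
Local Notation rvar a := (RGet a (INum 0)).
Local Notation "a <-i e" := (ISet a (INum 0) e) (at level 90).
Local Notation "a <-r e" := (RSet a (INum 0) e) (at level 90).
Local Notation inN := (IGet 0 (INum 0)).
Local Notation inK := (IGet 0 (INum 1)).
Local Notation inD := (IGet 0 (INum 2)).
Local Notation inEps := (RGet 0 (INum 0)).
Local Notation inDelta := (RGet 0 (INum 1)).
Local Notation iincr a := (a <-i IAdd (ivar a) (INum 1)).

(* Integer arrays: 3 scratch counter, 4 current sample, 5 multiples of the
   alphabet size k, 6 cell counts, 7 row counts (replicated over the k cells
   of the row), 8 block size k^(d+1), 9 smoothing parameter, 10 number of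
   samples read, 11 vertex, 12 start of its block, 13 row offset, 14 position
   in the parent lists, 15 symbol.  Real arrays: 1 output, 2 block size,
   3 powers of two, 4 min(1, eps).
   For k = 1 the loops over d and over the parents are skipped: there k^(d+1)
   does not bound their lengths. *)
Definition compute_block_size : cmd :=
  2 <-r RInt (INum 1) ;;
  If (BILt (INum 1) inK)
    (3 <-i INum 0 ;;
     While (BILt (ivar 3) (IAdd inD (INum 1)))
       (2 <-r RMul (rvar 2) (RInt inK) ;; iincr 3))
    Skip.

(** The block size is known only as a real, which cannot be rounded; an integer counter is raised
    until it reaches it. The same loop tabulates the multiples of k, making later multiplications by
    k lookups. *)
Definition tabulate_multiples : cmd :=
  While (BRLt (RInt (ivar 8)) (rvar 2))
    (ISet 5 (IAdd (ivar 8) (INum 1)) (IAdd (IGet 5 (ivar 8)) inK) ;; iincr 8).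

Definition rcells : rexp := RMul (rvar 2) (RInt inN).

(** A logarithm by doubling. The last increment keeps the pseudo-count positive even when delta is
    so large that the loop is never entered. *)
Definition compute_smoothing : cmd :=
  3 <-r RInt (INum 1) ;;
  While (BNot (BRLt (RDiv (RMul (RInt (INum 4)) rcells) inDelta) (rvar 3)))
    (3 <-r RAdd (rvar 3) (rvar 3) ;; iincr 9) ;;
  iincr 9.

(** With accuracy at most 1 the number of samples exceeds the pseudo-count, so the time of the
    doubling loop is covered by the bound in m. *)
Definition truncate_eps : cmd :=
  If (BRLt (RInt (INum 1)) inEps) (4 <-r RInt (INum 1)) (4 <-r inEps).

(** Horner's rule for the base-k number formed by the parent values. *)
Definition compute_row : cmd :=
  13 <-i INum 0 ;;
  If (BILt (INum 1) inK)
    (14 <-i IGet 1 (ivar 11) ;;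
     While (BILt (ivar 14) (IGet 1 (IAdd (ivar 11) (INum 1))))
       (13 <-i IAdd (IGet 5 (ivar 13)) (IGet 4 (IGet 2 (ivar 14))) ;;
        iincr 14))
    Skip ;;
  13 <-i IAdd (ivar 12) (IGet 5 (ivar 13)).

(** Replicating the row count over its cells lets the output loop run over flat addresses without
    dividing by k. *)
Definition count_vertex : cmd :=
  ISet 6 (IAdd (ivar 13) (IGet 4 (ivar 11)))
    (IAdd (IGet 6 (IAdd (ivar 13) (IGet 4 (ivar 11)))) (INum 1)) ;;
  15 <-i INum 0 ;;
  While (BILt (ivar 15) inK)
    (ISet 7 (IAdd (ivar 13) (ivar 15))
       (IAdd (IGet 7 (IAdd (ivar 13) (ivar 15))) (INum 1)) ;;
     iincr 15).

Definition process_sample : cmd :=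
  11 <-i INum 0 ;; 12 <-i INum 0 ;;
  While (BILt (ivar 11) inN)
    (compute_row ;; count_vertex ;;
     12 <-i IAdd (ivar 12) (ivar 8) ;; iincr 11).

Definition read_samples : cmd :=
  While (BNot (BRLt (RMul (RInt (INum 228)) (RMul rcells (RInt (ivar 9))))
                    (RMul (RInt (ivar 10)) (RMul (rvar 4) (rvar 4)))))
    (Sample 4 ;; process_sample ;; iincr 10).

(** The loop bound n k^(d+1) is what the last processed sample leaves in array 12; at least one
    sample is always read. *)
Definition write_output : cmd :=
  3 <-i INum 0 ;;
  While (BILt (ivar 3) (ivar 12))
    (RSet 1 (ivar 3)
       (RDiv (RAdd (RInt (IGet 6 (ivar 3))) (RInt (ivar 9)))
          (RAdd (RInt (IGet 7 (ivar 3))) (RMul (RInt inK) (RInt (ivar 9))))) ;;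
     iincr 3).

Definition learner : cmd :=
  compute_block_size ;; tabulate_multiples ;; compute_smoothing ;;
  truncate_eps ;; read_samples ;; write_output.

(** * Effect and cost of the preprocessing *)

Section Preprocessing.
Variable R : realType.
Implicit Types st : state R.

Lemma runs_compute_block_size st k d :
  imem st 0 1 = k -> imem st 0 2 = d -> (0 < k)%N ->
  runs compute_block_size st (100 * k ^ d.+1) (fun st' =>
    [/\ rmem st' 2 0 = (k ^ d.+1)%N%:R,
        frame [:: 3] (imem st) (imem st'),
        frame [:: 2] (rmem st) (rmem st') & pending st' = pending st]).
Proof.
move=> hk hd k0.
have D0 : (0 < k ^ d.+1)%N by rewrite expn_gt0 k0.
eapply runs_leB.
  apply: runs_seq; apply: runs_rset; apply: (@runs_if _ _ _ _ _ (80 * k ^ d.+1)).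
    rewrite /= hk => k1; eapply runs_le.
    - apply: runs_seq; apply: runs_iset.
      apply: (@runs_for _ _ _ (fun j st' => [/\ imem st' 3 0 = j,
        rmem st' 2 0 = (k ^ j)%N%:R, frame [:: 3] (imem st) (imem st'),
        frame [:: 2] (rmem st) (rmem st') & pending st' = pending st]) d.+1).
      + by split=> //=; apply: frame_upd.
      + move=> j st1 jd [h3 h2 fi fr hp] /=; rewrite h3 !fi // hd addn1 jd; split=> //.
        apply: runs_seq; apply: runs_rset; apply: runs_iset.
        split=> //=; try exact: frame_upd.
          by rewrite /upd /= h3 addn1.
        by rewrite /upd /= h2 fi // hk expnSr natrM.
      + by move=> st1 [h3 _ fi _ _] /=; rewrite h3 fi // hd addn1 ltnn.
    (* For k > 1 the d + 1 rounds are fewer than k^(d+1). *)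
    - by move=> /=; have := ltn_expl d.+1 k1; lia.
    - by move=> st' [].
  rewrite /= hk => k1; eapply runs_leB.
    apply: runs_skip => /=; split=> //; last exact: frame_upd.
    by rewrite (_ : k = 1%N) ?exp1n //; lia.
  by lia.
by rewrite /=; lia.
Qed.

Lemma runs_tabulate_multiples st k D :
  imem st 0 1 = k -> imem st 8 0 = 0%N -> imem st 5 0 = 0%N ->
  rmem st 2 0 = D%:R ->
  runs tabulate_multiples st (50 * D.+1) (fun st' =>
    [/\ imem st' 8 0 = D, forall c, (c <= D)%N -> imem st' 5 c = (c * k)%N,
        frame [:: 5; 8] (imem st) (imem st'),
        rmem st' = rmem st & pending st' = pending st]).
Proof.
move=> hk h8 h5 hD; eapply runs_le.
- apply: (@runs_for _ _ _ (fun j st' => [/\ imem st' 8 0 = j,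
    forall c, (c <= j)%N -> imem st' 5 c = (c * k)%N,
    frame [:: 5; 8] (imem st) (imem st'),
    rmem st' = rmem st & pending st' = pending st]) D).
  + by split=> // c; rewrite leqn0 => /eqP->.
  + move=> j st1 jD [g8 g5 fi hr hp] /=; rewrite g8 hr hD ltr_nat; split=> //.
    apply: runs_seq; apply: runs_iset; apply: runs_iset.
    split=> //=; last by do 2!apply: frame_upd => //.
      by rewrite /upd /= g8 addn1.
    move=> c; rewrite /upd /= g8 (fi 0%N) // hk addn1.
    by rewrite leq_eqVlt; case: eqP => [->|_ /= /g5->]; rewrite ?g5 // mulSnr.
  + by move=> st1 [g8 _ _ hr _] /=; rewrite g8 hr hD ltxx.
- by rewrite /=; lia.
- by [].
Qed.

(** One more than the least j with 2^j > 4 K / delta; truncation turns this into a comparison of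
    natural numbers. *)
Definition smoothing (K : nat) (delta : R) : nat :=
  (up_log 2 (Num.truncn (4 * K%:R / delta)).+1).+1.

Lemma runs_compute_smoothing st n D (delta : R) :
  imem st 0 0 = n -> imem st 9 0 = 0%N ->
  rmem st 0 1 = delta -> rmem st 2 0 = D%:R -> 0 < delta ->
  runs compute_smoothing st (50 * smoothing (D * n) delta) (fun st' =>
    [/\ imem st' 9 0 = smoothing (D * n) delta,
        frame [:: 9] (imem st) (imem st'),
        frame [:: 3] (rmem st) (rmem st') & pending st' = pending st]).
Proof.
move=> hn h9 hd hD d0; set N := up_log 2 (Num.truncn (4 * (D * n)%N%:R / delta)).+1.
have b0 : 0 <= 4 * (D * n)%N%:R / delta by rewrite !mulr_ge0 // invr_ge0 ltW.
have condE j : ((j < N)%N) = ((2 ^ j)%N%:R <= 4 * (D * n)%N%:R / delta :> R).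
  rewrite -truncn_ge_nat // -[RHS]ltnS; apply/idP/idP; last first.
    by move=> h; rewrite -(ltn_exp2l _ _ (isT : (1 < 2)%N)) (leq_trans h) // up_logP.
  by rewrite ltnNge => h; rewrite ltnNge; apply: contra h; apply: up_log_min.
eapply runs_leB.
- apply: runs_seq; apply: runs_rset; apply: runs_seq; eapply runs_le.
  + apply: (@runs_for _ _ _ (fun j st' => [/\ imem st' 9 0 = j,
      rmem st' 3 0 = (2 ^ j)%N%:R, frame [:: 9] (imem st) (imem st'),
      frame [:: 3] (rmem st) (rmem st') & pending st' = pending st]) N).
    * by split=> //=; apply: frame_upd.
    * move=> j st1 jN [h g fi fr hp] /=; rewrite g !fr // hD fi // hn hd.
      rewrite -natrM -leNgt -condE; split=> //.
      apply: runs_seq; apply: runs_rset; apply: runs_iset.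
      split=> //=; try exact: frame_upd.
        by rewrite /upd /= h addn1.
      by rewrite /upd /= g -natrD expnS mul2n addnn.
    * move=> st1 [h g fi fr hp] /=; rewrite g !fr // hD fi // hn hd.
      by rewrite -natrM negbK ltNge -condE ltnn.
  + exact: leqnn.
  + move=> st1 -[h g fi fr hp]; apply: runs_iset; split=> //=; last exact: frame_upd.
    by rewrite /upd /= h addn1.
- by rewrite /= /smoothing -/N; lia.
Qed.

Lemma runs_truncate_eps st (eps : R) : rmem st 0 0 = eps ->
  runs truncate_eps st 50 (fun st' =>
    [/\ rmem st' 4 0 = Num.min 1 eps, imem st' = imem st,
        frame [:: 4] (rmem st) (rmem st') & pending st' = pending st]).
Proof.
move=> he; eapply runs_leB.
  apply: (@runs_if _ _ _ _ _ 10) => /=; rewrite he => h; eapply runs_leB;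
    try (apply: runs_rset; split=> //=; last exact: frame_upd); rewrite ?leqnn //.
    by rewrite /upd /= minEle ltW.
  by rewrite /upd /= he minElt (negbTE h).
by [].
Qed.

End Preprocessing.

(** * Counting the hits of one sample *)

Section Counting.
Variable R : realType.
Implicit Types st : state R.

(** The value 0 for k <= 1 mirrors the skipped loop; for k = 1 every digit is 0 anyway. *)
Definition row_number (k : nat) (starts pa x : nat -> nat) (i : nat) : nat :=
  if (1 < k)%N then
    foldl (fun c p => c * k + x (pa p))%N 0%N
      (iota (starts i) (starts i.+1 - starts i))
  else 0%N.

Lemma eq_row_number k starts pa (x y : nat -> nat) i :
  (forall p, (starts i <= p < starts i.+1)%N -> x (pa p) = y (pa p)) ->
  row_number k starts pa x i = row_number k starts pa y i.
Proof.
move=> h; rewrite /row_number; case: ifP => // _.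
have {}h p : p \in iota (starts i) (starts i.+1 - starts i) ->
    x (pa p) = y (pa p) by rewrite mem_iota => hp; apply: h; lia.
elim: iota 0%N h => //= p ps IHp c h; rewrite h ?mem_head //; apply: IHp => t tp.
by rewrite h // inE tp orbT.
Qed.

Lemma starts_mono (n d : nat) (starts : nat -> nat) i :
  (forall i, (i < n)%N -> (starts i <= starts i.+1 <= starts i + d)%N) ->
  (i <= n)%N -> (starts i <= starts n)%N.
Proof.
move=> starts_le iN; rewrite -(subnKC iN); have : (i + (n - i) <= n)%N by lia.
elim: (n - i)%N => [|r IHr]; first by rewrite addn0.
rewrite addnS => h; apply: leq_trans (IHr (ltnW h)) _.
by have /andP[] := starts_le _ h.
Qed.

Section FixedGraph.
Variables (n k d : nat) (starts pa : nat -> nat).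
Local Notation D := (k ^ d.+1)%N.
Local Notation row := (row_number k starts pa).
Hypothesis n0 : (0 < n)%N.
Hypothesis k0 : (0 < k)%N.
Hypothesis starts_le : forall i, (i < n)%N ->
  (starts i <= starts i.+1 <= starts i + d)%N.
Hypothesis pa_lt : forall p, (p < starts n)%N -> (pa p < n)%N.

Definition graph_memory st : Prop :=
  [/\ imem st 0 0 = n, imem st 0 1 = k,
      forall j, (j <= n)%N -> imem st 1 j = starts j,
      forall j, imem st 2 j = pa j &
      imem st 8 0 = D /\ forall c, (c <= D)%N -> imem st 5 c = (c * k)%N].

Lemma graph_memory_frame s st st' :
  frame s (imem st) (imem st') -> all (fun a => a \notin s) [:: 0; 1; 2; 5; 8]%N ->
  graph_memory st -> graph_memory st'.
Proof.
move=> fr /= /and5P[a0 a1 a2 a5 /andP[a8 _]] [h0 hk h1 h2 [h8 h5]].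
split; rewrite ?fr //; first by move=> j jn; rewrite fr // h1.
  by move=> j; rewrite fr // h2.
by split=> // c cD; rewrite fr // h5.
Qed.

Let D_gt0 : (0 < D)%N. Proof. by rewrite expn_gt0 k0. Qed.
Let k_leD : (k <= D)%N. Proof. by rewrite expnS leq_pmulr // expn_gt0 k0. Qed.

Lemma runs_compute_row st (x : nat -> nat) i b :
  graph_memory st -> imem st 11 0 = i -> imem st 12 0 = b ->
  (forall j, imem st 4 j = x j) -> (forall j, (j < n)%N -> (x j < k)%N) ->
  (i < n)%N ->
  runs compute_row st (200 * D) (fun st' =>
    [/\ imem st' 13 0 = (b + row x i * k)%N,
        frame [:: 13; 14] (imem st) (imem st'),
        rmem st' = rmem st & pending st' = pending st]).
Proof.
move=> [h0 hk h1 h2 [h8 h5]] hi hb h4 xk iN.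
have /andP[st1 st2] := starts_le iN.
set F := fun t => foldl (fun c p => c * k + x (pa p))%N 0%N (iota (starts i) t).
have FS t : F t.+1 = (F t * k + x (pa (starts i + t)))%N.
  by rewrite /F -addn1 iotaD foldl_cat.
have xp t : (t < starts i.+1 - starts i)%N -> (x (pa (starts i + t)%N) < k)%N.
  move=> ht; apply: xk; apply: pa_lt; have := starts_mono starts_le iN; lia.
have Fk t : (t <= starts i.+1 - starts i)%N -> (F t < k ^ t)%N.
  elim: t => [|t IHt] ht; first by rewrite expn0.
  rewrite FS expnSr; have := IHt (ltnW ht); have := xp _ ht; nia.
(* Partial Horner values stay inside the tabulated range of array 5. *)
have FD t : (t <= starts i.+1 - starts i)%N -> (F t <= D)%N.
  move=> ht; apply: leq_trans (ltnW (Fk _ ht)) _.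
  by rewrite leq_pexp2l //; lia.
eapply runs_leB.
  apply: runs_seq; apply: runs_iset; apply: runs_seq.
  apply: (@runs_le _ _ _ (150 * D + 20) _ (fun st' =>
    [/\ imem st' 13 0 = row x i,
        frame [:: 13; 14] (imem st) (imem st'),
        rmem st' = rmem st & pending st' = pending st])).
  - apply: (@runs_leB _ _ _ (bcost (BILt (INum 1) inK) + 150 * D).+1);
      last by rewrite /=; lia.
    apply: runs_if; rewrite /= [upd _ _ _ _ 0%N 1%N]/upd /= hk => k1; last first.
      eapply runs_leB.
        apply: runs_skip => /=; split=> //; last exact: frame_upd.
        by rewrite /upd /= /row_number (negbTE k1).
      lia.
    rewrite /row_number k1; eapply runs_le.
    + apply: runs_seq; apply: runs_iset.
      apply: (@runs_for _ _ _ (fun t st' => [/\ imem st' 14 0 = (starts i + t)%N,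
        imem st' 13 0 = F t, frame [:: 13; 14] (imem st) (imem st'),
        rmem st' = rmem st & pending st' = pending st]) (starts i.+1 - starts i)).
      * split=> //=; last by do 2!apply: frame_upd => //.
        by rewrite /upd /= hi h1 ?addn0 // ltnW.
      * move=> t st' ht [g14 g13 fi hr hp] /=.
        rewrite g14 !(fi 11%N) // hi !(fi 1%N) // addn1 h1 //.
        split; first by lia.
        apply: runs_seq; apply: runs_iset; apply: runs_iset.
        split=> //=; last by do 2!apply: frame_upd => //.
          by rewrite /upd /= g14; lia.
        rewrite /upd /= g13 g14 (fi 5%N) // h5 ?FD //; last exact: ltnW.
        by rewrite (fi 2%N) // (fi 4%N) // h4 h2 FS.
      * move=> st' [g14 _ fi _ _] /=.
        rewrite g14 !(fi 11%N) // hi !(fi 1%N) // addn1 h1 //; lia.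
    + have : (d.+1 < D)%N by apply: ltn_expl.
      by rewrite /=; nia.
    + by move=> st' [].
  - exact: leqnn.
  - move=> st' [g13 fi hr hp]; apply: runs_iset; split=> //=; last exact: frame_upd.
    rewrite /upd /= g13 (fi 12%N) // (fi 5%N) // hb h5 //.
    by rewrite /row_number; case: ifP => // _; apply: (FD _ (leqnn _)).
by rewrite /=; lia.
Qed.

Lemma runs_count_vertex st i o xi :
  imem st 0 1 = k -> imem st 11 0 = i -> imem st 13 0 = o -> imem st 4 i = xi ->
  runs count_vertex st (200 * D) (fun st' =>
    [/\ forall j, imem st' 6 j = (imem st 6 j + (j == o + xi))%N,
        forall j, imem st' 7 j = (imem st 7 j + (o <= j < o + k))%N,
        frame [:: 6; 7; 15] (imem st) (imem st'),
        rmem st' = rmem st & pending st' = pending st]).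
Proof.
move=> hk hi ho hx; eapply runs_le.
- apply: runs_seq; apply: runs_iset; apply: runs_seq; apply: runs_iset.
  apply: (@runs_for _ _ _ (fun a st' => [/\ imem st' 15 0 = a,
    forall j, imem st' 6 j = (imem st 6 j + (j == o + xi))%N,
    forall j, imem st' 7 j = (imem st 7 j + (o <= j < o + a))%N,
    frame [:: 6; 7; 15] (imem st) (imem st') &
    rmem st' = rmem st /\ pending st' = pending st]) k).
  + split=> //=; last by do 2!apply: frame_upd => //.
      move=> j; rewrite /upd /= ho hi hx.
      by case: eqP => [->|_]; rewrite ?addn0.
    move=> j; rewrite /upd /=; have -> : (o <= j < o + 0)%N = false by lia.
    by rewrite addn0.
  + move=> a st1 ak [g15 g6 g7 fi [hr hp]] /=; rewrite g15 (fi 0%N) // hk ak; split=> //.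
    apply: runs_seq; apply: runs_iset; apply: runs_iset.
    split=> //=; last by do 2!apply: frame_upd => //.
      by rewrite /upd /= g15 addn1.
    move=> j; rewrite /upd /= g15 (fi 13%N) // ho !g7.
    by case: eqP => [->|ne]; lia.
  + by move=> st1 [g15 _ _ fi _] /=; rewrite g15 (fi 0%N) // hk ltnn.
- by rewrite /=; nia.
- by move=> st' [_ g6 g7 fi [hr hp]].
Qed.

(** Stated for raw addresses, summing over all vertices; that their blocks are disjoint enters only
    with the encoding, through [block_eq]. *)
Definition cell_hits (x : nat -> nat) (j : nat) : nat :=
  \sum_(0 <= i < n) (j == i * D + row x i * k + x i).
Definition row_hits (x : nat -> nat) (j : nat) : nat :=
  \sum_(0 <= i < n) (i * D + row x i * k <= j < i * D + row x i * k + k).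

Lemma runs_process_sample st (x : nat -> nat) :
  graph_memory st -> (forall j, imem st 4 j = x j) ->
  (forall j, (j < n)%N -> (x j < k)%N) ->
  runs process_sample st (1000 * (D * n)) (fun st' =>
    [/\ forall j, imem st' 6 j = (imem st 6 j + cell_hits x j)%N,
        forall j, imem st' 7 j = (imem st 7 j + row_hits x j)%N,
        frame [:: 6; 7; 11; 12; 13; 14; 15] (imem st) (imem st'),
        imem st' 12 0 = (n * D)%N &
        rmem st' = rmem st /\ pending st' = pending st]).
Proof.
move=> gm h4 xk; eapply runs_le.
- apply: runs_seq; apply: runs_iset; apply: runs_seq; apply: runs_iset.
  apply: (@runs_for _ _ _ (fun i st' => [/\
    imem st' 11 0 = i /\ imem st' 12 0 = (i * D)%N,
    forall j, imem st' 6 j = (imem st 6 j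
      + \sum_(0 <= i < i) (j == i * D + row x i * k + x i))%N,
    forall j, imem st' 7 j = (imem st 7 j + \sum_(0 <= i < i)
      (i * D + row x i * k <= j < i * D + row x i * k + k))%N,
    frame [:: 6; 7; 11; 12; 13; 14; 15] (imem st) (imem st') &
    rmem st' = rmem st /\ pending st' = pending st]) n (450 * D)).
  + split=> //=.
    * by move=> j; rewrite big_geq // addn0.
    * by move=> j; rewrite big_geq // addn0.
    * by do 2!apply: frame_upd => //.
  + move=> i st1 iN [[g11 g12] g6 g7 fi [hr hp]].
    have gm1 := graph_memory_frame fi isT gm.
    have [e0 _ _ _ _] := gm1; rewrite /= g11 e0 iN; split=> //.
    have e4 j : imem st1 4 j = x j by rewrite fi.
    eapply runs_leB.
      apply: runs_seq; apply: runs_le (leqnn _) _.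
        exact: (runs_compute_row gm1 g11 g12 e4 xk iN).
      move=> st2 [g13 fi2 hr2 hp2].
      have gm2 := graph_memory_frame fi2 isT gm1.
      apply: runs_seq; apply: runs_le (leqnn _) _.
        apply: (runs_count_vertex (o := i * D + row x i * k) (xi := x i) (i := i)).
        - by have [] := gm2.
        - by rewrite fi2.
        - by rewrite g13.
        - by rewrite fi2.
      move=> st3 [f6 f7 fi3 hr3 hp3]; apply: runs_seq; apply: runs_iset.
      apply: runs_iset; split=> /=.
      * rewrite /upd /= !fi3 // !fi2 // g11 g12 addn1; split=> //.
        by have [_ _ _ _ [-> _]] := gm1; rewrite mulSnr.
      * by move=> j; rewrite /upd /= f6 fi2 // g6 big_nat_recr //= addnA.
      * by move=> j; rewrite /upd /= f7 fi2 // g7 big_nat_recr //= addnA.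
      * do 2!apply: frame_upd => //.
        apply: frame_trans fi3 _ _; first apply: frame_trans fi fi2 _ _.
        - exact: (fun _ h => h).
        - by apply/allP.
        - exact: (fun _ h => h).
        - by apply/allP.
      * by rewrite hr3 hr2 hp3 hp2.
    by rewrite /=; lia.
  + move=> st1 [[g11 _] _ _ fi _] /=.
    by have [e0 _ _ _ _] := graph_memory_frame fi isT gm; rewrite g11 e0 ltnn.
- rewrite /=; nia.
- by move=> st' [[_ g12] g6 g7 fi hrp].
Qed.

End FixedGraph.
End Counting.

(** * The complete run *)

Definition sample_size (R : realType) (n k d : nat) (eps delta : R) : nat :=
  let K := (k ^ d.+1 * n)%N in
  (Num.truncn (228 * (K%:R * (smoothing K delta)%:R)
     / (Num.min 1 eps * Num.min 1 eps))).+1.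

Section Learner.
Variable R : realType.
Implicit Types st : state R.
Variables (n k d : nat) (starts pa : nat -> nat).
Local Notation D := (k ^ d.+1)%N.
Local Notation row := (row_number k starts pa).
Hypothesis n0 : (0 < n)%N.
Hypothesis k0 : (0 < k)%N.
Hypothesis starts_le : forall i, (i < n)%N ->
  (starts i <= starts i.+1 <= starts i + d)%N.
Hypothesis pa_lt : forall p, (p < starts n)%N -> (pa p < n)%N.

Lemma eq_row (x y : nat -> nat) i : (forall j, (j < n)%N -> x j = y j) ->
  (i < n)%N -> row x i = row y i.
Proof.
move=> xy iN; apply: eq_row_number => p hp; apply: xy; apply: pa_lt.
have := starts_mono starts_le iN; lia.
Qed.

Lemma eq_cell_hits (x y : nat -> nat) : (forall j, (j < n)%N -> x j = y j) ->
  cell_hits n k d starts pa x =1 cell_hits n k d starts pa y.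
Proof.
move=> xy j; rewrite /cell_hits !big_mkord.
by apply: eq_bigr => i _; rewrite (eq_row xy) // xy.
Qed.

Lemma eq_row_hits (x y : nat -> nat) : (forall j, (j < n)%N -> x j = y j) ->
  row_hits n k d starts pa x =1 row_hits n k d starts pa y.
Proof.
move=> xy j; rewrite /row_hits !big_mkord.
by apply: eq_bigr => i _; rewrite (eq_row xy).
Qed.

Definition total_cell_hits (s : seq (seq nat)) (j : nat) : nat :=
  \sum_(v <- s) cell_hits n k d starts pa (nth 0%N v) j.
Definition total_row_hits (s : seq (seq nat)) (j : nat) : nat :=
  \sum_(v <- s) row_hits n k d starts pa (nth 0%N v) j.

Definition wf_samples (s : seq (seq nat)) : Prop :=
  forall v, v \in s -> size v = n /\ forall j, (j < n)%N -> (nth 0%N v j < k)%N.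

Lemma runs_read_samples st (s : seq (seq nat)) l (e : R) :
  graph_memory n k d starts pa st ->
  imem st 9 0 = l -> imem st 10 0 = 0%N ->
  (forall j, imem st 6 j = 0%N) -> (forall j, imem st 7 j = 0%N) ->
  rmem st 2 0 = D%:R -> rmem st 4 0 = e -> 0 < e -> pending st = s ->
  size s = (Num.truncn (228 * ((D * n)%N%:R * l%:R) / (e * e))).+1 ->
  wf_samples s ->
  runs read_samples st (1100 * (D * size s * n)) (fun st' =>
    [/\ imem st' 12 0 = (n * D)%N,
        forall j, imem st' 6 j = total_cell_hits s j,
        forall j, imem st' 7 j = total_row_hits s j,
        frame [:: 4; 6; 7; 10; 11; 12; 13; 14; 15] (imem st) (imem st') &
        rmem st' = rmem st /\ pending st' = [::]]).
Proof.
move=> gm h9 h10 h6 h7 r2 r4 e0 hp hs wf.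
have D0 : (0 < D)%N by rewrite expn_gt0 k0.
have condE c : (c < size s)%N
    = (c%:R * (e * e) <= 228 * (D%:R * n%:R * l%:R)).
  have b0 : 0 <= 228 * ((D * n)%N%:R * l%:R) / (e * e).
    by rewrite divr_ge0 ?mulr_ge0 // ltW.
  by rewrite hs ltnS truncn_ge_nat // ler_pdivlMr ?mulr_gt0 // natrM.
eapply runs_le.
- apply: (@runs_for _ _ _ (fun c st' => [/\
    imem st' 10 0 = c /\ ((0 < c)%N -> imem st' 12 0 = (n * D)%N),
    forall j, imem st' 6 j = total_cell_hits (take c s) j,
    forall j, imem st' 7 j = total_row_hits (take c s) j,
    frame [:: 4; 6; 7; 10; 11; 12; 13; 14; 15] (imem st) (imem st') &
    rmem st' = rmem st /\ pending st' = drop c s]) (size s) (1050 * (D * n))).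
  + split=> //; rewrite ?take0 ?drop0 //.
    * by move=> j; rewrite h6 /total_cell_hits big_nil.
    * by move=> j; rewrite h7 /total_row_hits big_nil.
  + move=> c st1 cs [[g10 _] g6 g7 fi [hr hp1]].
    have gm1 := graph_memory_frame fi isT gm.
    have [e00 _ _ _ _] := gm1.
    rewrite /= hr r2 r4 e00 g10 (fi 9%N) // h9 -leNgt -condE cs; split=> //.
    rewrite (drop_nth [::]) // in hp1.
    have [sv vk] := wf _ (mem_nth [::] cs); set v := nth [::] s c in hp1 sv vk.
    (* [Sample] overwrites only the first n cells of array 4; what lies beyond is harmless by
       [eq_cell_hits] and [eq_row_hits]. *)
    set x := fun j => if (j < n)%N then nth 0%N v j else imem st1 4 j.
    have xv j : (j < n)%N -> x j = nth 0%N v j by rewrite /x => ->.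
    eapply runs_leB.
      apply: runs_seq; apply: (runs_sample hp1); apply: runs_seq.
      have fi2 : frame [:: 4] (imem st1) (upd_seq (imem st1) 4 v).
        exact: frame_upd_seq.
      set st2 := State _ _ _.
      have gm2 := graph_memory_frame (st' := st2) fi2 isT gm1.
      apply: runs_le (leqnn _) _.
        apply: (runs_process_sample n0 k0 starts_le pa_lt (x := x) gm2).
        - by move=> j; rewrite /= /upd_seq eqxx /= sv.
        - by move=> j jn; rewrite xv // vk.
      move=> st3 [f6 f7 fi3 f12 [hr3 hp3]]; apply: runs_iset; split=> /=.
      * rewrite /upd /= fi3 //= /upd_seq /= g10 addn1; split=> // _.
      * move=> j; rewrite /upd /= f6 /= /upd_seq /= g6 (take_nth [::]) //.
        by rewrite /total_cell_hits -cats1 big_cat big_seq1 (eq_cell_hits xv).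
      * move=> j; rewrite /upd /= f7 /= /upd_seq /= g7 (take_nth [::]) //.
        by rewrite /total_row_hits -cats1 big_cat big_seq1 (eq_row_hits xv).
      * apply: frame_upd => //; apply: frame_trans fi3 _ _.
        - by apply: frame_trans fi fi2 (fun _ h => h) _; apply/allP.
        - exact: (fun _ h => h).
        - by apply/allP.
      * by rewrite hr3 hp3.
    by rewrite /= sv; nia.
  + move=> st1 [[g10 _] _ _ fi [hr _]].
    have [e00 _ _ _ _] := graph_memory_frame fi isT gm.
    by rewrite /= hr r2 r4 e00 g10 (fi 9%N) // h9 negbK ltNge -condE ltnn.
- rewrite /= hs; nia.
- move=> st' [[_ g12] g6 g7 fi [hr hp']]; split=> //.
  + by apply: g12; rewrite hs.
  + by move=> j; rewrite g6 take_size.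
  + by move=> j; rewrite g7 take_size.
  + by rewrite hp' drop_size.
Qed.

Lemma runs_write_output st N l :
  imem st 0 1 = k -> imem st 9 0 = l -> imem st 12 0 = N ->
  runs write_output st (100 * N.+1) (fun st' =>
    (forall j, (j < N)%N -> rmem st' 1 j =
      ((imem st 6 j)%:R + l%:R) / ((imem st 7 j)%:R + k%:R * l%:R))
    /\ pending st' = pending st).
Proof.
move=> hk h9 h12; eapply runs_le.
- apply: runs_seq; apply: runs_iset.
  apply: (@runs_for _ _ _ (fun t st' => [/\ imem st' 3 0 = t,
    forall j, (j < t)%N -> rmem st' 1 j =
      ((imem st 6 j)%:R + l%:R) / ((imem st 7 j)%:R + k%:R * l%:R),
    frame [:: 3] (imem st) (imem st') & pending st' = pending st]) N).
  + by split=> //=; apply: frame_upd.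
  + move=> t st1 tN [g3 g1 fi hp] /=; rewrite g3 (fi 12%N) // h12 tN; split=> //.
    apply: runs_seq; apply: runs_rset; apply: runs_iset.
    split=> //=; last by apply: frame_upd.
      by rewrite /upd /= g3 addn1.
    move=> j; rewrite ltnS leq_eqVlt /upd /= g3 !fi // h9 hk.
    by case: eqP => [->|_ /= /g1].
  + by move=> st1 [g3 _ fi _] /=; rewrite g3 (fi 12%N) // h12 ltnn.
- by rewrite /=; lia.
- by move=> st' [_ g1 _ hp].
Qed.

Lemma runs_learner st (eps delta : R) (s : seq (seq nat)) :
  imem st 0 0 = n -> imem st 0 1 = k -> imem st 0 2 = d ->
  (forall j, (j <= n)%N -> imem st 1 j = starts j) ->
  (forall j, imem st 2 j = pa j) ->
  (forall a j, (2 < a)%N -> imem st a j = 0%N) ->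
  rmem st 0 0 = eps -> rmem st 0 1 = delta -> 0 < eps -> 0 < delta ->
  pending st = s -> size s = sample_size n k d eps delta -> wf_samples s ->
  let l := (smoothing (D * n) delta)%:R in
  runs learner st (3000 * (D * size s * n)) (fun st' =>
    (forall j, (j < n * D)%N -> rmem st' 1 j =
      ((total_cell_hits s j)%:R + l) / ((total_row_hits s j)%:R + k%:R * l))
    /\ pending st' = [::]).
Proof.
move=> hn hk hd h1 h2 hz he hdl e0 d0 hp hs wf l.
have D0 : (0 < D)%N by rewrite expn_gt0 k0.
have m0 : (0 < size s)%N by rewrite hs.
(* The doubling loop depends on delta, so only the factor m can pay for it. *)
have ms : (smoothing (D * n) delta <= size s)%N.
  rewrite hs /sample_size ltnW // ltnS truncn_ge_nat; last first.
    by rewrite divr_ge0 ?mulr_ge0 // le_min ler01 ltW.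
  set e := Num.min 1 eps.
  have ep : 0 < e by rewrite lt_min ltr01.
  have e1 : e <= 1 by rewrite ge_min lexx.
  rewrite ler_pdivlMr ?mulr_gt0 //.
  have K1 : 1 <= (D * n)%N%:R :> R by rewrite ler1n muln_gt0 D0.
  have ee : e * e <= 1 by nra.
  have : 0 <= (smoothing (D * n) delta)%:R :> R by [].
  nra.
eapply runs_leB.
  apply: runs_seq; apply: runs_le (leqnn _) _.
    exact: (runs_compute_block_size hk hd k0).
  move=> s1 [a2 ai ar ap]; apply: runs_seq; apply: runs_le (leqnn _) _.
    apply: (runs_tabulate_multiples (k := k) _ _ _ a2); by rewrite ai // hz.
  move=> s2 [b8 b5 bi br bp]; apply: runs_seq; apply: runs_le (leqnn _) _.
    apply: (runs_compute_smoothing (n := n) (D := D) (delta := delta)) => //.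
    - by rewrite bi // ai.
    - by rewrite bi // ai // hz.
    - by rewrite br ar.
    - by rewrite br.
  move=> s3 [c9 ci cr cp]; apply: runs_seq; apply: runs_le (leqnn _) _.
    apply: (runs_truncate_eps (eps := eps)).
    by rewrite cr // br ar.
  move=> s4 [d4 di dr dp]; apply: runs_seq; apply: runs_le (leqnn _) _.
    have o a j : a \notin [:: 3; 5; 8; 9] -> imem s4 a j = imem st a j.
      rewrite !inE !negb_or => /and4P[n3 n5 n8 n9].
      by rewrite di ci ?inE // bi ?inE ?negb_or ?n5 ?n8 // ai ?inE.
    apply: (runs_read_samples (s := s) (l := smoothing (D * n) delta)
      (e := Num.min 1 eps)) => //.
    - split; [by rewrite o|by rewrite o| | |split].
      + by move=> j jn; rewrite o ?h1.
      + by move=> j; rewrite o.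
      + by rewrite di ci // b8.
      + by move=> c cD; rewrite di ci // b5.
    - by rewrite di.
    - by rewrite o // hz.
    - by move=> j; rewrite o // hz.
    - by move=> j; rewrite o // hz.
    - by rewrite dr // cr // br.
    - by rewrite lt_min ltr01.
    - by rewrite dp cp bp ap.
  move=> s5 [f12 f6 f7 fi [fr fp]].
  have o a j : a \notin [:: 4; 6; 7; 10; 11; 12; 13; 14; 15] ->
    imem s5 a j = imem s3 a j by move=> h; rewrite fi // di.
  apply: runs_le (leqnn _) _.
    apply: (runs_write_output (N := n * D) (l := smoothing (D * n) delta)) => //.
    - by rewrite o // ci // bi // ai.
    - by rewrite o.
  move=> s6 [g1 gp]; split; last by rewrite gp.
  by move=> j jN; rewrite g1 // f6 f7.
have h : (D <= D * size s * n)%N by rewrite -mulnA leq_pmulr // muln_gt0 m0.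
have h' : (smoothing (D * n) delta <= D * size s * n)%N.
  by apply: leq_trans ms _; rewrite mulnAC leq_pmull // muln_gt0 D0.
have h'' : (n * D <= D * size s * n)%N by rewrite mulnC mulnAC leq_pmulr.
move: h h' h''; set X := (D * size s * n)%N; lia.
Qed.

End Learner.

(** * Encoding of graphs and samples *)

Section Digits.
Variable k : nat.

Definition of_digits (s : seq nat) : nat := foldl (fun c v => c * k + v)%N 0%N s.

Lemma of_digits_rcons s v : of_digits (rcons s v) = (of_digits s * k + v)%N.
Proof. by rewrite /of_digits foldl_rcons. Qed.

Lemma of_digits_lt s : all (fun v => v < k)%N s -> (of_digits s < k ^ size s)%N.
Proof.
elim/last_ind: s => [|s v IHs]; first by rewrite expn0.
rewrite all_rcons of_digits_rcons size_rcons expnSr => /andP[vk /IHs]; nia.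
Qed.

(** Remainder and quotient by k recover the last digit and the rest; equal lengths exclude ambiguity
    from leading zeros. *)
Lemma eq_of_digits s t : size s = size t ->
  all (fun v => v < k)%N s -> all (fun v => v < k)%N t ->
  (of_digits s == of_digits t) = (s == t).
Proof.
elim/last_ind: s t => [|s v IHs] t.
  by move/esym/size0nil => ->; rewrite !eqxx.
case/lastP: t => [|t w]; first by rewrite size_rcons.
rewrite !size_rcons !all_rcons !of_digits_rcons eqseq_rcons.
move=> [/IHs h] /andP[vk sk] /andP[wk tk]; rewrite -h //.
apply/eqP/andP => [e|[/eqP-> /eqP->] //].
have k0 : (0 < k)%N by apply: leq_ltn_trans vk.
have ev := congr1 (modn^~ k) e; rewrite !modnMDl !modn_small // in ev.
have ed := congr1 (divn^~ k) e; rewrite !divnMDl // !divn_small // !addn0 in ed.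
by rewrite ed ev.
Qed.

End Digits.

Lemma block_eq (D i j a b : nat) : (a < D)%N -> (b < D)%N ->
  (i * D + a == j * D + b)%N = (i == j) && (a == b).
Proof.
move=> aD bD; apply/eqP/andP => [e|[/eqP-> /eqP->] //].
have D0 : (0 < D)%N by apply: leq_ltn_trans aD.
have ev := congr1 (modn^~ D) e; rewrite !modnMDl !modn_small // in ev.
have ed := congr1 (divn^~ D) e; rewrite !divnMDl // !divn_small // !addn0 in ed.
by rewrite ed ev.
Qed.

Section Encoding.
Variables (n : nat) (Sigma : finType) (G : rel 'I_n) (d : nat).
Hypothesis indeg : forall i : 'I_n, (#|parents G i| <= d)%N.
Hypothesis Sigma0 : (0 < #|Sigma|)%N.
Local Notation k := #|Sigma|.
Local Notation D := (k ^ d.+1)%N.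
Implicit Types x u : {ffun 'I_n -> Sigma}.

Definition list_start (j : nat) : nat := \sum_(i < n | (i < j)%N) #|parents G i|.

Definition parent_lists : seq (seq nat) :=
  [seq [seq val p | p <- enum (parents G i)] | i <- enum 'I_n].

Definition parent_at (p : nat) : nat := nth 0%N (flatten parent_lists) p.

Lemma list_startS (i : 'I_n) :
  list_start i.+1 = (list_start i + #|parents G i|)%N.
Proof.
rewrite /list_start (bigD1 i) //= addnC; congr addn.
by apply: eq_bigl => j; rewrite ltnS [RHS]ltn_neqAle andbC -val_eqE.
Qed.

Lemma size_parent_lists : size parent_lists = n.
Proof. by rewrite size_map size_enum_ord. Qed.

Lemma nth_parent_lists (i : 'I_n) :
  nth [::] parent_lists i = [seq val p | p <- enum (parents G i)].
Proof. by rewrite (nth_map i) ?size_enum_ord // nth_ord_enum. Qed.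

Lemma size_flatten_take j : (j <= n)%N ->
  size (flatten (take j parent_lists)) = list_start j.
Proof.
elim: j => [|j IHj] jn; first by rewrite take0 /list_start big_pred0.
rewrite (take_nth [::]) ?size_parent_lists // flatten_rcons size_cat.
rewrite IHj 1?ltnW // (list_startS (Ordinal jn)); congr addn.
by rewrite (nth_parent_lists (Ordinal jn)) size_map cardE.
Qed.

Lemma parent_at_iota (i : 'I_n) :
  [seq parent_at p | p <- iota (list_start i) #|parents G i|]
    = [seq val p | p <- enum (parents G i)].
Proof.
have iN : (i < size parent_lists)%N by rewrite size_parent_lists.
have e : flatten parent_lists = flatten (take i parent_lists)
    ++ [seq val p | p <- enum (parents G i)]
    ++ flatten (drop i.+1 parent_lists).
  rewrite -{1}(cat_take_drop i parent_lists) flatten_cat (drop_nth [::]) //=.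
  by rewrite nth_parent_lists.
have sz : size (flatten (take i parent_lists)) = list_start i.
  by rewrite size_flatten_take // ltnW.
rewrite map_nth_iota e; last first.
  by rewrite !size_cat sz size_map -cardE addKn leq_addr.
by rewrite drop_size_cat // take_size_cat // size_map -cardE.
Qed.

Lemma list_start_le i : (i < n)%N ->
  (list_start i <= list_start i.+1 <= list_start i + d)%N.
Proof.
move=> iN; rewrite (list_startS (Ordinal iN)) /= leq_addr leq_add2l.
exact: indeg.
Qed.

Lemma parent_at_lt p : (p < list_start n)%N -> (parent_at p < n)%N.
Proof.
rewrite -(size_flatten_take (leqnn n)) take_oversize ?size_parent_lists //.
rewrite /parent_at => /(mem_nth 0%N)/flattenP[t /mapP[i _ ->] /mapP[q _ ->]].
exact: ltn_ord.
Qed.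

Definition parent_digits (i : 'I_n) x : seq nat :=
  [seq val (enum_rank (x p)) | p <- enum (parents G i)].

Lemma parent_digits_lt i x : all (fun v => v < k)%N (parent_digits i x).
Proof. by apply/allP => v /mapP[p _ ->]; apply: ltn_ord. Qed.

Lemma size_parent_digits i x : size (parent_digits i x) = #|parents G i|.
Proof. by rewrite size_map cardE. Qed.

Lemma nth_encode_sample x (i : 'I_n) :
  nth 0%N (encode_sample x) i = enum_rank (x i).
Proof. by rewrite (nth_map i) ?size_enum_ord // nth_ord_enum. Qed.

Lemma row_number_encode x (i : 'I_n) :
  row_number k list_start parent_at (nth 0%N (encode_sample x)) i
    = of_digits k (parent_digits i x).
Proof.
rewrite /row_number list_startS addKn; case: ifP => k1; last first.
  have /eqP k1' : k == 1%N by rewrite eqn_leq Sigma0 leqNgt k1.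
  have := of_digits_lt (parent_digits_lt i x).
  by rewrite [in X in (_ < X)%N]k1' exp1n; case: of_digits.
rewrite /parent_digits /of_digits.
have -> : [seq val (enum_rank (x p)) | p <- enum (parents G i)]
    = [seq nth 0%N (encode_sample x) (parent_at p)
        | p <- iota (list_start i) #|parents G i|].
  rewrite [RHS](map_comp (nth 0%N (encode_sample x)) parent_at) parent_at_iota.
  by rewrite -map_comp; apply: eq_map => p /=; rewrite nth_encode_sample.
move: (nth 0%N _) => y; move: (iota _ _) {1 2}0%N.
by elim=> //= p ps IHp c; rewrite IHp.
Qed.

Lemma eq_parent_digits i x u :
  (of_digits k (parent_digits i x) == of_digits k (parent_digits i u))
    = (parent_values G i x == parent_values G i u).
Proof.
rewrite eq_of_digits ?parent_digits_lt ?size_parent_digits //.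
rewrite eq_parent_values; apply/eqP/agreeP => [/eq_in_map h j jp|h].
  by apply/esym/enum_rank_inj/val_inj/h; rewrite mem_enum.
by apply/eq_in_map => j; rewrite mem_enum => jp; rewrite h.
Qed.

Lemma cell_offset_lt i x (v : nat) : (v < k)%N ->
  (of_digits k (parent_digits i x) * k + v < D)%N.
Proof.
move=> vk; have h := of_digits_lt (parent_digits_lt i x).
rewrite size_parent_digits in h.
have : (k ^ #|parents G i| <= k ^ d)%N by rewrite leq_pexp2l.
rewrite expnSr; nia.
Qed.

Let pos (i : 'I_n) u (a : Sigma) : nat :=
  (i * D + (of_digits k (parent_digits i u) * k + enum_rank a))%N.

(** Offsets are smaller than a block, so only vertex i hits its own block, and the base-k digits
    determine the parent values and the symbol. *)
Lemma cell_hits_encode x i u a :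
  cell_hits n k d list_start parent_at (nth 0%N (encode_sample x)) (pos i u a)
    = cell_event (parent_values G i) (fun y => y i) (parent_values G i u) a x.
Proof.
rewrite /cell_hits big_mkord.
under eq_bigr => j _ do rewrite row_number_encode nth_encode_sample -addnA
  block_eq ?cell_offset_lt //.
rewrite (bigD1 i) //= big1 ?addn0 => [|j ji]; last first.
  by rewrite eq_sym val_eqE (negbTE ji).
rewrite eqxx /= block_eq // eq_parent_digits val_eqE (inj_eq enum_rank_inj).
by rewrite /cell_event eq_sym [a == _]eq_sym.
Qed.

Lemma row_hits_encode x i u a :
  row_hits n k d list_start parent_at (nth 0%N (encode_sample x)) (pos i u a)
    = row_event (parent_values G i) (parent_values G i u) x.
Proof.
have h (j : 'I_n) : (j * D + of_digits k (parent_digits j x) * k <= pos i u a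
      < j * D + of_digits k (parent_digits j x) * k + k)%N
    = (i == j) && row_event (parent_values G i) (parent_values G i u) x.
  rewrite /row_event -eq_parent_digits; apply/idP/andP => [/andP[h1 h2]|].
    have [v vk e] : exists2 v, (v < k)%N & (pos i u a == j * D
        + (of_digits k (parent_digits j x) * k + v))%N.
      exists (pos i u a - (j * D + of_digits k (parent_digits j x) * k))%N.
        by rewrite ltn_subLR.
      by rewrite addnA subnKC.
    move: e; rewrite block_eq ?cell_offset_lt //.
    case/andP => /eqP/val_inj ij; rewrite -ij eqxx block_eq //.
    by case/andP => /eqP->.
  case=> /eqP<- /eqP->; by rewrite /pos addnA leq_addr ltn_add2l ltn_ord.
rewrite /row_hits big_mkord.
under eq_bigr => j _ do rewrite row_number_encode h.
rewrite (bigD1 i) //= eqxx big1 ?addn0 // => j ji.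
by rewrite eq_sym (negbTE ji).
Qed.

Lemma wf_encode (s : seq {ffun 'I_n -> Sigma}) :
  wf_samples n k [seq encode_sample x | x <- s].
Proof.
move=> v /mapP[x _ ->]; split=> [|j jn]; first by rewrite size_map size_enum_ord.
by rewrite (nth_encode_sample x (Ordinal jn)).
Qed.

Lemma output_cpt_estimator (R : realType) (st : state R)
    (s : seq {ffun 'I_n -> Sigma}) (l : R) :
  (forall j, (j < n * D)%N -> rmem st 1 j =
    ((total_cell_hits n k d list_start parent_at
        [seq encode_sample x | x <- s] j)%:R + l)
    / ((total_row_hits n k d list_start parent_at
        [seq encode_sample x | x <- s] j)%:R + k%:R * l)) ->
  forall i u a, output_cpt G d st i u a = estimator G l s i u a.
Proof.
move=> h i u a; rewrite /output_cpt -/(of_digits k _) of_digits_rcons -/(pos i u a).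
rewrite h; last first.
  have := cell_offset_lt i u (ltn_ord (enum_rank a)); have := ltn_ord i.
  by rewrite /pos; nia.
rewrite /estimator /smoothed /total_cell_hits /total_row_hits !big_map.
congr ((_%:R + l) / (_%:R + _)).
  by elim: s {h} => [|x s IHs]; rewrite ?big_nil // big_cons cell_hits_encode IHs.
by elim: s {h} => [|x s IHs]; rewrite ?big_nil // big_cons row_hits_encode IHs.
Qed.

End Encoding.

(** * Sample size *)

Section SampleSize.
Variable R : realType.

(** The doubling loop works in base 2, and exp l >= 2^l. *)
Lemma smoothing_large (K : nat) (delta : R) : 0 < delta ->
  4 * K%:R <= delta * expR (smoothing K delta)%:R.
Proof.
move=> d0; rewrite -ler_pdivrMl // mulrC.
have b0 : 0 <= 4 * K%:R / delta by rewrite !mulr_ge0 // invr_ge0 ltW.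
have /andP[_ h] := truncn_itv b0; apply: le_trans (ltW h) _.
apply: (@le_trans _ _ ((2 ^ smoothing K delta)%N%:R)).
  rewrite ler_nat /smoothing expnS.
  by apply: leq_trans (up_logP _ (isT : (1 < 2)%N)) _; exact: leq_pmull.
rewrite natrX -[X in expR X]mulr1 expRM_natl lerXn2r ?nnegrE ?expR_ge0 //.
by have := expR_ge1Dx (1 : R); lra.
Qed.

Lemma sample_size_large (n k d : nat) (eps delta : R) : 0 < eps ->
  228 * (k ^ d.+1 * n)%N%:R * (smoothing (k ^ d.+1 * n) delta)%:R
    <= (sample_size n k d eps delta)%:R * eps ^+ 2.
Proof.
move=> e0; set e := Num.min 1 eps.
have ep : 0 < e by rewrite lt_min ltr01.
pose B : R := 228 * ((k ^ d.+1 * n)%N%:R * (smoothing (k ^ d.+1 * n) delta)%:R).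
have b0 : 0 <= B / (e * e) by rewrite divr_ge0 ?mulr_ge0 // ltW.
have /andP[_] := truncn_itv b0; rewrite ltr_pdivrMr ?mulr_gt0 // => h.
rewrite -[leLHS]mulrA -/B; apply: le_trans (ltW h) _.
rewrite ler_wpM2l // expr2.
by apply: ler_pM; rewrite ?ge_min ?lexx ?orbT // ltW.
Qed.

(** A sum of logarithms is bounded by their product because both stay away from 0: x = ln K >= a =
    ln 2 and y = ln (1/delta) >= b = ln (1/delta0). In 4 a + x + y the parts 4 a and x cost 4/b and
    1/b times x y, and y costs 1/a. *)
Lemma smoothing_le (delta0 : R) : 0 < delta0 < 1 ->
  exists2 C : R, 0 < C & forall (K : nat) (delta : R),
    (1 < K)%N -> 0 < delta <= delta0 ->
    (smoothing K delta)%:R <= C * (ln K%:R * ln (1 / delta)).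
Proof.
move=> /andP[d00 d01].
have a0 : 0 < ln 2 :> R by rewrite ln_gt0 // ltr1n.
have b0 : 0 < ln (1 / delta0) by rewrite ln_gt0 // div1r invf_gt1.
set a := ln 2 in a0; set b := ln (1 / delta0) in b0.
exists ((5 / b + 1 / a) / a) => [|K delta K1 /andP[d0 dle]].
  by rewrite divr_gt0 // addr_gt0 ?divr_gt0.
have K0 : 0 < K%:R :> R by rewrite ltr0n; lia.
have xa : a <= ln K%:R by rewrite ler_ln ?posrE // ler_nat.
have yb : b <= ln (1 / delta).
  by rewrite ler_ln ?posrE ?divr_gt0 // !div1r lef_pV2 ?posrE.
set x := ln K%:R in xa *; set y := ln (1 / delta) in yb *.
have d1 : 1 < delta^-1 by rewrite invf_gt1 //; lra.
have four : ln 4 = 2 * a :> R.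
  have -> : 4 = 2 ^+ 2 :> R by ring.
  by rewrite lnXn // mulr_natl.
have lE : ln (4 * K%:R / delta) = 2 * a + x + y.
  by rewrite !lnM ?posrE ?mulr_gt0 ?invr_gt0 // four /y div1r.
have K1R : 1 <= K%:R :> R by rewrite ler1n; lia.
have b1 : 1 <= 4 * K%:R / delta by nra.
set T := Num.truncn (4 * K%:R / delta).
have T1 : (0 < T)%N by rewrite truncn_gt0.
(* By minimality of [up_log], the preceding power of two is still at most 4 K / delta. *)
have up : ((up_log 2 T.+1).-1)%:R * a <= 2 * a + x + y.
  rewrite -lE (mulr_natl a) /a -lnXn //.
  have p0 : 0 < 2 ^+ (up_log 2 T.+1).-1 :> R by rewrite exprn_gt0.
  rewrite ler_ln ?posrE //; last by lra.
  apply: (@le_trans _ _ T%:R); last by rewrite truncn_le; lra.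
  by rewrite -natrX ler_nat -ltnS up_log_gtn.
have up0 : (0 < up_log 2 T.+1)%N by rewrite up_log_gt0.
have sE : (smoothing K delta)%:R = ((up_log 2 T.+1).-1)%:R + 2 :> R.
  by rewrite /smoothing -/T -natrD; congr _%:R; lia.
have {}up : (smoothing K delta)%:R * a <= 4 * a + x + y by rewrite sE; lra.
have x0 : 0 < x by lra.
have y0 : 0 < y by lra.
have -> : (5 / b + 1 / a) / a * (x * y) = (4 * x * y / b + x * y / b + x * y / a) / a.
  by field; rewrite !gt_eqF.
rewrite ler_pdivlMr //; apply: le_trans up _; apply: lerD; first apply: lerD.
- by rewrite ler_pdivlMr //; nra.
- by rewrite ler_pdivlMr //; nra.
- by rewrite ler_pdivlMr //; nra.
Qed.

(** The factor 1 + eps0^2 undoes the truncation of eps at 1, and 229 = 228 + 1 absorbs the rounding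
    up. *)
Lemma sample_size_le (eps0 delta0 : R) : 0 < eps0 -> 0 < delta0 < 1 ->
  exists C : R, forall (n k d : nat) (eps delta : R),
    (1 < k ^ d.+1 * n)%N -> 0 < eps <= eps0 -> 0 < delta <= delta0 ->
    (sample_size n k d eps delta)%:R <=
      C * ((k ^ d.+1 * n)%N%:R * ln (k ^ d.+1 * n)%N%:R
           * eps ^- 2 * ln (1 / delta)).
Proof.
move=> e00 d0; have [C C0 hC] := smoothing_le d0.
exists (229 * C * (1 + eps0 ^+ 2)) => n k d eps delta.
set K := (k ^ d.+1 * n)%N => K1 /andP[e0 ele] dd.
have := hC K delta K1 dd; set l := smoothing K delta.
set x := ln K%:R; set y := ln (1 / delta) => hl.
have K1R : 1 <= K%:R :> R by rewrite ler1n; lia.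
have l1 : 1 <= l%:R :> R by rewrite ler1n.
set e := Num.min 1 eps.
have ep : 0 < e by rewrite lt_min ltr01.
have e1 : e <= 1 by rewrite ge_min lexx.
have ie : (e * e)^-1 <= (1 + eps0 ^+ 2) * eps ^- 2.
  have p2 : 0 < eps ^+ 2 by rewrite exprn_gt0.
  rewrite ler_pdivlMr // mulrC ler_pdivrMr ?mulr_gt0 //.
  have q0 : 0 <= eps0 ^+ 2 by rewrite sqr_ge0.
  rewrite /e minElt; case: ifP => _; first by nra.
  by rewrite expr2; have := mulr_ge0 q0 (ltW p2); rewrite expr2; nra.
have ie1 : 1 <= (e * e)^-1 by rewrite invf_ge1 ?mulr_gt0 //; nra.
have Kl : 1 <= K%:R * l%:R :> R by nra.
apply: (@le_trans _ _ (229 * (K%:R * l%:R) * (e * e)^-1)).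
  rewrite /sample_size -/K -/l -/e -natr1.
  have : (Num.truncn (228 * (K%:R * l%:R) / (e * e)))%:R
      <= 228 * (K%:R * l%:R) / (e * e).
    by rewrite truncn_le divr_ge0 ?mulr_ge0 // ltW.
  have : 1 <= K%:R * l%:R * (e * e)^-1 by nra.
  lra.
have -> : 229 * C * (1 + eps0 ^+ 2) * (K%:R * x * eps ^- 2 * y)
    = 229 * (K%:R * (C * (x * y))) * ((1 + eps0 ^+ 2) * eps ^- 2) by ring.
apply: ler_pM ie; rewrite ?invr_ge0 ?mulr_ge0 //; try exact: ltW.
by rewrite ler_wpM2l // ler_wpM2l.
Qed.

End SampleSize.

(** * Learning guarantee with sample and time bounds *)

Theorem theorem4p4 (R : realType) :
  exists (A : cmd) (m : nat -> nat -> nat -> R -> R -> nat),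
    (forall eps0 delta0 : R, 0 < eps0 -> 0 < delta0 < 1 ->
      exists C : R,
      forall (n k d : nat) (eps delta : R),
        (1 < k ^ d.+1 * n)%N ->
        0 < eps <= eps0 -> 0 < delta <= delta0 ->
        (m n k d eps delta)%:R <=
          C * ((k ^ d.+1 * n)%N%:R * ln (k ^ d.+1 * n)%N%:R
               * eps ^- 2 * ln (1 / delta)))
    /\
    exists C : nat,
    forall (n : nat) (Sigma : finType) (d : nat) (G : rel 'I_n)
           (eps delta : R),
      (0 < n)%N -> (0 < #|Sigma|)%N ->
      acyclic G -> (forall i : 'I_n, #|parents G i| <= d)%N ->
      0 < eps -> 0 < delta ->
      exists final : (m n #|Sigma| d eps delta).-tuple {ffun 'I_n -> Sigma} ->
                     state R,
        (forall s : (m n #|Sigma| d eps delta).-tuple {ffun 'I_n -> Sigma},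
           (exists2 t : nat,
              exec A (input_state G d eps delta s) t (final s)
              & (t <= C * (#|Sigma| ^ d.+1 * m n #|Sigma| d eps delta * n))%N)
           /\ pending (final s) = [::]
           /\ is_cpt (output_cpt (Sigma := Sigma) G d (final s))
           /\ is_bayesnet G
                (bn_of_cpt (output_cpt (Sigma := Sigma) G d (final s))))
        /\
        forall P : {ffun 'I_n -> Sigma} -> R, is_bayesnet G P ->
          1 - delta <=
          iid_prob P
            (fun s : (m n #|Sigma| d eps delta).-tuple {ffun 'I_n -> Sigma} =>
               dTV P (bn_of_cpt (output_cpt G d (final s))) <= eps).
Proof.
exists learner, (@sample_size R); split; first exact: sample_size_le.
exists 3000%N => n Sigma d G eps delta n0 k0 acG indeg e0 d0.
set m := sample_size _ _ _ _ _.
have l0 : 0 < (smoothing (#|Sigma| ^ d.+1 * n) delta)%:R :> R by rewrite ltr0n.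
(* The sample tuples form a finite type, so final states are selected by finite choice. *)
have /fin_all_exists[final hf] (s : m.-tuple {ffun 'I_n -> Sigma}) :
    exists st, [/\ exists2 t, exec learner (input_state G d eps delta s) t st
        & (t <= 3000 * (#|Sigma| ^ d.+1 * m * n))%N,
      pending st = [::]
      & forall i u a, output_cpt G d st i u a
          = estimator G (smoothing (#|Sigma| ^ d.+1 * n) delta)%:R s i u a].
  have h1 j : (j <= n)%N ->
      imem (input_state G d eps delta s) 1 j = list_start G j.
    by move=> jn /=; rewrite jn.
  have hz a j : (2 < a)%N -> imem (input_state G d eps delta s) a j = 0%N.
    by case: a => [|[|[|a]]].
  have sz : size [seq encode_sample x | x <- s] = m.
    by rewrite size_map size_tuple.
  have := runs_learner n0 k0 (list_start_le indeg) (@parent_at_lt n G)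
    (st := input_state G d eps delta s) erefl erefl erefl h1 (fun=> erefl) hz
    erefl erefl e0 d0 erefl sz (@wf_encode n Sigma s).
  rewrite sz => -[t [st [ex ht [out pend]]]].
  exists st; split=> //; first by exists t.
  exact: output_cpt_estimator.
have /card_gt0P[a0 _] := k0.
pose x0 : {ffun 'I_n -> Sigma} := [ffun=> a0].
exists final; split=> [s|P bP].
  have [ex pend out] := hf s.
  have cpt : is_cpt (output_cpt (Sigma := Sigma) G d (final s)).
    move=> i u; have [q0 q1] := estimator_cpt G s l0 i u.
    split=> [a|]; first by rewrite out.
    by rewrite -q1; apply: eq_bigr => a _; rewrite out.
  split=> //; split=> //; split=> //.
  apply: bn_of_cpt_bayesnet x0 => // i x y xy a.
  by rewrite !out; apply: estimator_local.
have Pd := bP.1.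
apply: le_trans (estimator_dTV (m := m) acG indeg k0 _ l0 bP (ltW e0)
  (smoothing_large _ d0) (sample_size_large _ _ _ _ e0)) _ => //.
apply: (iid_prob_sub Pd) => s; have [_ _ out] := hf s.
suff -> : dTV P (bn_of_cpt (output_cpt G d (final s)))
  = dTV P (bn_of_cpt (estimator G
      (smoothing (#|Sigma| ^ d.+1 * n) delta)%:R s)) by [].
congr (_ * _); apply: eq_bigr => x _; congr `|_ - _|.
by apply: eq_bigr => i _; rewrite out.
Qed.
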